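(* Let $d\ge2$, let $\kappa$ be a regular Borel probability measure on $\mathbb{S}_{d-1}$, let $(Y_t)_{t\ge0}$ be the splitting process with initial tessellation $\{\mathbb{S}^d\}$ and direction distribution $\kappa$, and for $t\ge0$ let $\overline{Y}_t$ be a Poisson great hypersphere tessellation with direction distribution $\kappa$ and time parameter (intensity) $t$. Define the cell intensity measures on $\mathbb{P}^d$ by $$\mathsf{M}_t:=\mathbf{E}\sum_{c\in Y_t}\delta_c,\qquad\overline{\mathsf{M}}_t:=\mathbf{E}\sum_{c\in\overline{Y}_t}\delta_c .$$ Then $\mathsf{M}_t=\overline{\mathsf{M}}_t$ for every $t\ge0$.
   Context: $\mathbb{S}^d$ is the unit sphere in $\mathbb{R}^{d+1}$. A spherical polytope is the intersection of $\mathbb{S}^d$ with a polyhedral cone, i.e. with an intersection of finitely many (possibly zero) closed half-spaces of $\mathbb{R}^{d+1}$ having the origin in their boundaries; $\mathbb{P}^d$ is the set of non-empty spherical polytopes, with the Borel $\sigma$-field of the Hausdorff distance. A tessellation of $\mathbb{S}^d$ is a finite set $T$ of $d$-dimensional spherical polytopes (cells) with pairwise disjoint interiors and union $\mathbb{S}^d$; $\mathbb{T}^d$ is the set of all tessellations, with the $\sigma$-field generated by $T\mapsto|T\cap B|$, $B\subset\mathbb{P}^d$ Borel. $\mathbb{S}_{d-1}$ is the space of great hyperspheres (intersections of $\mathbb{S}^d$ with $d$-dimensional linear subspaces); $S^\pm$ are the closed half-spheres bounded by $S$; $\mathbb{S}_{d-1}[c]:=\{S:S\cap\operatorname{int}(c)\ne\emptyset\}$.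 A Borel measure $\kappa$ on $\mathbb{S}_{d-1}$ is regular if $\kappa(\{S:e\in S\})=0$ for all $e\in\mathbb{S}^d$. Splitting process: for $c\in T$, $S\in\mathbb{S}_{d-1}[c]$ put $\oslash(c,S,T):=(T\setminus\{c\})\cup\{c\cap S^+,c\cap S^-\}$. The splitting process with initial tessellation $\{\mathbb{S}^d\}$ and direction distribution $\kappa$ is the continuous-time pure jump Markov process on $\mathbb{T}^d$ with $Y_0=\{\mathbb{S}^d\}$ and generator $(\mathcal{A}f)(T)=\sum_{c\in T}\int_{\mathbb{S}_{d-1}[c]}[f(\oslash(c,S,T))-f(T)]\,\kappa(\mathrm{d}S)$ for bounded measurable $f$. Equivalently: independently, each existing cell $c$ has an exponential lifetime with parameter $\kappa(\mathbb{S}_{d-1}[c])$ and is then split into $c\cap S^+$, $c\cap S^-$ by a random $S$ with distribution $\kappa(\cdot\cap\mathbb{S}_{d-1}[c])/\kappa(\mathbb{S}_{d-1}[c])$. Poisson great hypersphere tessellation with direction distribution $\kappa$ and time parameter $t$: the random tessellation $\overline{Y}_t$ whose cells are the closures of the connected components of the complement in $\mathbb{S}^d$ of the union of the great hyperspheres of a Poisson process on $\mathbb{S}_{d-1}$ with intensity measure $t\kappa$ ($\overline{Y}_t=\{\mathbb{S}^d\}$ if there are none). *)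

(* Defs.v *)
From HB Require Import structures.
From mathcomp Require Import all_boot all_order all_algebra.
From mathcomp Require Import all_classical all_reals all_analysis.

Set Implicit Arguments.
Unset Strict Implicit.
Unset Printing Implicit Defensive.

Import Order.TTheory GRing.Theory Num.Theory.
Import numFieldTopology.Exports numFieldNormedType.Exports.

Local Open Scope classical_set_scope.
Local Open Scope card_scope.
Local Open Scope ring_scope.

(* Points of the sphere S^d are row vectors of R^(d+1); subsets of S^d are
   subsets of 'rV[R]_d.+1 contained in [sphere]. *)

Section geometry.
Context {R : realType} {d : nat}.
Local Notation V := 'rV[R]_d.+1.
Implicit Types (u v x y : V) (A B : set V) (U W : {vspace V}).

Definition dot x y : R := \sum_i x 0 i * y 0 i.

Definition edist x y : R := Num.sqrt (dot (x - y) (x - y)).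

Definition sphere : set V := [set x | dot x x = 1].

(* With respect to the Euclidean distance; the geodesic distance of the sphere
   yields the same topology. *)
Definition hausdorff_dist A B : R :=
  Num.max (sup [set inf [set edist x y | y in B] | x in A])
          (sup [set inf [set edist x y | x in A] | y in B]).

(* Interior relative to S^d. *)
Definition sinterior A : set V :=
  [set x | sphere x /\ within sphere (nbhs x) A].

Definition polyhedral_cone A : Prop :=
  exists n (u : 'I_n -> V), (forall i, u i != 0) /\
    A = [set x | forall i, 0 <= dot (u i) x].

Definition spherical_polytope A : Prop :=
  exists2 C, polyhedral_cone C & A = sphere `&` C.

Definition linear_hull A U : Prop :=
  A `<=` [set` U] /\ forall W, A `<=` [set` W] -> (U <= W)%VS.

(* The dimension of a spherical polytope is that of its linear hull, minus 1. *)
Definition has_sdim A (k : nat) : Prop :=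
  exists2 U, linear_hull A U & \dim U = k.+1.

Definition great_hypersphere A : Prop :=
  exists2 U, \dim U = d & A = sphere `&` [set` U].

(* The closed half-spheres bounded by the great hypersphere S: exactly two,
   S^+ and S^-, given by the two orientations of the normal u. *)
Definition half_sphere_of (S : set V) : set (set V) :=
  [set h | exists u, [/\ u != 0, S = [set x | sphere x /\ dot u x = 0] &
                        h = [set x | sphere x /\ 0 <= dot u x]]].

End geometry.

Section geometry_lemmas.
Context {R : realType} {d : nat}.
Local Notation V := 'rV[R]_d.+1.
Implicit Types (u v w x y : V) (A B : set V) (U W : {vspace V}).

Lemma dotC x y : dot x y = dot y x.
Proof. by apply: eq_bigr => i _; rewrite mulrC. Qed.

Lemma dotDr x y z : dot x (y + z) = dot x y + dot x z.
Proof. by rewrite -big_split; apply: eq_bigr => i _ /=; rewrite mxE mulrDr. Qed.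

Lemma dotZr a x y : dot x (a *: y) = a * dot x y.
Proof. by rewrite mulr_sumr; apply: eq_bigr => i _; rewrite mxE mulrCA. Qed.

Lemma dotDl x y z : dot (x + y) z = dot x z + dot y z.
Proof. by rewrite dotC dotDr !(dotC z). Qed.

Lemma dotZl a x y : dot (a *: x) y = a * dot x y.
Proof. by rewrite dotC dotZr dotC. Qed.

Lemma dotNr x y : dot x (- y) = - dot x y.
Proof. by rewrite -scaleN1r dotZr mulN1r. Qed.

Lemma dotNl x y : dot (- x) y = - dot x y.
Proof. by rewrite dotC dotNr dotC. Qed.

Lemma dot_ge0 x : 0 <= dot x x.
Proof. by apply: sumr_ge0 => i _; rewrite -expr2 sqr_ge0. Qed.

Lemma dot_eq0 x : (dot x x == 0) = (x == 0).
Proof.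
apply/idP/eqP => [|->]; last by rewrite -(scale0r 0) dotZr mul0r.
rewrite psumr_eq0 => [/allP h|i _]; last by rewrite -expr2 sqr_ge0.
apply/rowP => i; rewrite mxE; apply/eqP.
by have := h i (mem_index_enum _); rewrite -expr2 sqrf_eq0.
Qed.

Lemma dot_gt0 x : (0 < dot x x) = (x != 0).
Proof. by rewrite lt_neqAle dot_ge0 andbT eq_sym dot_eq0. Qed.

Definition normalize x : V := (Num.sqrt (dot x x))^-1 *: x.

Lemma normalize_sphere x : x != 0 -> sphere (normalize x).
Proof.
rewrite -dot_gt0 => x0; rewrite /sphere /normalize /= dotZr dotZl mulrA -expr2.
by rewrite exprVn sqr_sqrtr ?mulVf ?(ltW x0)// gt_eqF.
Qed.

Lemma sphere_neq0 x : sphere x -> x != 0.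
Proof. by move=> x1; rewrite -dot_gt0 x1. Qed.

Lemma sint_normalize A x v : sinterior A x ->
  exists2 e : R, 0 < e & x + e *: v != 0 /\ A (normalize (x + e *: v)).
Proof.
move=> [x1 Ax].
pose D (e : R) : R := dot (x + e *: v) (x + e *: v).
have D0 : D 0 = 1 by rewrite /D scale0r addr0.
have DE : D = (fun e => 1 + (dot x v + dot x v) * e + dot v v * e * e).
  apply/funext => e; rewrite /D dotDl !dotDr !dotZl !dotZr (dotC v x) x1.
  by rewrite mulrDl !(mulrC e) addrA addrA.
have cD : D e @[e --> (0 : R)] --> (1 : R).
  rewrite -[X in _ --> X]D0 DE; apply: cvgD; first apply: cvgD; first exact: cvg_cst.
    by apply: cvgM; [exact: cvg_cst|exact: cvg_id].
  apply: cvgM; last exact: cvg_id.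
  by apply: cvgM; [exact: cvg_cst|exact: cvg_id].
have cN : normalize (x + e *: v) @[e --> (0 : R)] --> x.
  have cs : (Num.sqrt (D e))^-1 @[e --> (0 : R)] --> (1 : R).
    rewrite -[X in _ --> X]invr1; apply: cvgV; first exact: oner_neq0.
    rewrite -[X in _ --> X]sqrtr1.
    by apply: (cvg_comp _ _ cD); exact: sqrt_continuous.
  rewrite -[X in _ --> X]scale1r; apply: (cvgZ cs).
  rewrite -[X in _ --> X]addr0 -(scale0r v); apply: cvgD; first exact: cvg_cst.
  by apply: cvgZr_tmp; exact: cvg_id.
have nz : \forall e \near (0 : R), 0 < D e by exact: (cvgr_gt _ cD) ltr01.
have [e0 /= e00 H] : \forall e \near (0 : R),
    x + e *: v != 0 /\ A (normalize (x + e *: v)).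
  near=> e.
  have xe0 : x + e *: v != 0 by rewrite -dot_gt0; near: e.
  split=> //; have := normalize_sphere xe0.
  by near: e; exact: cN Ax.
exists (e0 / 2); first exact: divr_gt0.
apply: H; rewrite /= sub0r normrN ger0_norm ?divr_ge0 ?(ltW e00)//.
by rewrite gtr_pMr// invf_lt1// ltr1n.
Unshelve. all: by end_near. Qed.

Lemma linear_hull_full A :
  (forall W, A `<=` [set` W] -> forall v, v \in W) -> has_sdim A d.
Proof.
move=> h; exists fullv; last by rewrite dimvf /= /dim /= mul1n.
split=> [x _ /=|W AW]; first exact: memvf.
by apply/subvP => v _; exact: h.
Qed.

Lemma interior_has_sdim A : sinterior A !=set0 -> has_sdim A d.
Proof.
case=> x ix; apply: linear_hull_full => W AW v.
have inW y : y != 0 -> A (normalize y) -> y \in W.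
  move=> y0 /AW /= /(memvZ (Num.sqrt (dot y y))); rewrite scalerA divff ?scale1r//.
  by rewrite sqrtr_eq0 -ltNge dot_gt0.
have xW : x \in W.
  have [e _ [x0 Ax]] := sint_normalize 0 ix.
  by rewrite scaler0 addr0 in x0 Ax; exact: inW.
have [e e0 [xe0 Axe]] := sint_normalize v ix.
have /memvB/(_ xW) := inW _ xe0 Axe; rewrite addrAC subrr add0r.
by move=> /(memvZ e^-1); rewrite scalerA mulVf ?scale1r// gt_eqF.
Qed.

Lemma subspace_normal U : \dim U = d ->
  exists2 u, u != 0 & forall x, (x \in U) = (dot u x == 0).
Proof.
move=> dU; pose B := \matrix_(j < d.+1, i < d) (vbasis U)`_i 0 j.
have /eqP/matrixP K0 : kermx B != 0.
  rewrite -mxrank_eq0 mxrank_ker -lt0n subn_gt0 ltnS.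
  exact: rank_leq_col.
have [i [j Kij]] : exists i j, kermx B i j != 0.
  apply: contrapT => h; apply: K0 => i j; rewrite [RHS]mxE.
  by apply: contrapT => /eqP Kij; apply: h; exists i, j.
pose u := row i (kermx B).
have u0 : u != 0 by apply: contra_neq Kij => /rowP/(_ j); rewrite mxE => ->; rewrite mxE.
have uU x : x \in U -> dot u x = 0.
  move=> /coord_vbasis ->.
  rewrite /dot; under eq_bigr do rewrite summxE mulr_sumr.
  rewrite exchange_big big1 // => k _ /=.
  under eq_bigr do rewrite [X in _ * X]mxE mulrCA.
  rewrite -mulr_sumr [X in _ * X](_ : _ = 0) ?mulr0//.
  have /rowP/(_ (cast_ord dU k)) : u *m B = 0 by rewrite -row_mul mulmx_ker row0.
  rewrite !mxE => h; rewrite -[RHS]h; apply: eq_bigr => l _.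
  by rewrite [B _ _]mxE.
exists u => // x; apply/idP/eqP => [|ux]; first exact: uU.
apply: contraT => xU.
have : (U + <[x]>)%VS = fullv.
  have dV : \dim (fullv : {vspace V}) = d.+1 by rewrite dimvf /= /dim /= mul1n.
  apply/eqP; rewrite -(dimv_leqif_eq (subvf _)).2 eqn_leq dimvS ?subvf//= dV.
  have := dimv_leqif_sup (addvSl U <[x]>); rewrite dU => -[dle deq].
  rewrite ltn_neqAle dle andbT deq subv_add subvv /=.
  by apply: contra xU; rewrite memvE.
move=> full; have := memvf u; rewrite -full => /memv_addP[y /uU uy [_ /vlineP[k ->] uE]].
suff : dot u u == 0 by rewrite dot_eq0 (negbTE u0).
by rewrite {2}uE dotDr dotZr uy ux mulr0 addr0.
Qed.

Lemma normal_uniq u v : u != 0 -> v != 0 ->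
  [set x | sphere x /\ dot u x = 0] = [set x | sphere x /\ dot v x = 0] ->
  exists2 a, a != 0 & v = a *: u.
Proof.
move=> u0 v0 uv; pose a := dot u v / dot u u; pose w := v - a *: u.
have uu0 : dot u u != 0 by rewrite dot_eq0.
have uw : dot u w = 0 by rewrite dotDr dotNr dotZr divfK// subrr.
have w0 : w = 0.
  apply/eqP; apply: contraT => w0.
  have : [set x | sphere x /\ dot u x = 0] (normalize w).
    by split; [exact: normalize_sphere|rewrite dotZr uw mulr0].
  rewrite uv => -[_ /eqP]; rewrite dotZr mulf_eq0 invr_eq0 sqrtr_eq0.
  rewrite leNgt dot_gt0 w0 /= => /eqP vw.
  suff : dot w w == 0 by rewrite dot_eq0 (negbTE w0).
  by rewrite {1}/w dotDl dotNl dotZl vw uw mulr0 subrr.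
have va : v = a *: u by apply/eqP; rewrite -subr_eq0 -/w w0.
by exists a => //; apply: contra_neq v0 => a0; rewrite va a0 scale0r.
Qed.

End geometry_lemmas.

Section spaces.
Variables (R : realType) (d : nat).
Local Notation V := 'rV[R]_d.+1.

Definition nonempty_polytope (A : set V) : Prop :=
  A !=set0 /\ spherical_polytope A.

Definition polytope : Type := {A : set V | nonempty_polytope A}.

Definition hypersphere : Type := {S : set V | great_hypersphere S}.

Definition is_tessellation (T : set polytope) : Prop :=
  [/\ finite_set T,
      forall c, T c -> has_sdim (sval c) d,
      trivIset T (fun c => sinterior (sval c)) &
      \bigcup_(c in T) sval c = sphere].

Definition tessellation : Type := {T : set polytope | is_tessellation T}.

Lemma sphere_nonempty : (sphere : set V) !=set0.
Proof.
exists (normalize (const_mx 1)); apply: normalize_sphere.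
by apply/eqP => /rowP/(_ ord0); rewrite !mxE => /eqP; rewrite oner_eq0.
Qed.

Lemma sphere_interior (x : V) : sphere x -> sinterior sphere x.
Proof. by split=> //; exact: withinT. Qed.

Lemma sphere_polytope : nonempty_polytope sphere.
Proof.
split; first exact: sphere_nonempty.
exists setT; last by rewrite setIT.
exists 0%N, (fun=> 0); split=> [[]//|].
by apply/seteqP; split=> // x _ [].
Qed.

Definition whole_sphere : polytope := exist _ sphere sphere_polytope.

Lemma trivial_tessellation : is_tessellation [set whole_sphere].
Proof.
split=> [|c ->|c c' -> ->//|]; first exact: finite_set1.
- by apply: interior_has_sdim; have [x /sphere_interior] := sphere_nonempty; exists x.
- by rewrite bigcup_set1.
Qed.

Definition tess0 : tessellation := exist _ _ trivial_tessellation.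

Lemma hypersphere_nonempty : exists S : set V, great_hypersphere S.
Proof.
exists (sphere `&` [set` (<[const_mx 1]>^C)%VS]), (<[const_mx 1]>^C)%VS => //.
rewrite dimv_compl dim_vline dimvf /= /dim /= mul1n.
suff -> : const_mx 1 != 0 :> V by rewrite subn1.
by apply/eqP => /rowP/(_ ord0); rewrite !mxE => /eqP; rewrite oner_eq0.
Qed.

HB.instance Definition _ := gen_eqMixin polytope.
HB.instance Definition _ := gen_choiceMixin polytope.
HB.instance Definition _ := isPointed.Build polytope whole_sphere.

HB.instance Definition _ := gen_eqMixin hypersphere.
HB.instance Definition _ := gen_choiceMixin hypersphere.
HB.instance Definition _ := isPointed.Build hypersphere
  (exist _ _ (projT2 (cid hypersphere_nonempty))).

HB.instance Definition _ := gen_eqMixin tessellation.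
HB.instance Definition _ := gen_choiceMixin tessellation.
HB.instance Definition _ := isPointed.Build tessellation tess0.

Definition hausdorff_open (P : set V -> Prop) : set (set {A : set V | P A}) :=
  [set G | forall A, G A -> exists2 e : R, 0 < e &
     forall B, hausdorff_dist (sval A) (sval B) < e -> G B].

HB.instance Definition _ := Measurable.copy polytope
  (g_sigma_algebraType (@hausdorff_open _ : set (set polytope))).
HB.instance Definition _ := Measurable.copy hypersphere
  (g_sigma_algebraType (@hausdorff_open _ : set (set hypersphere))).

(* The sets {T : |T /\ B| = n}. *)
Definition cell_count_sets : set (set tessellation) :=
  [set E | exists (B : set polytope) (n : nat), measurable B /\
     E = [set T | sval T `&` B #= `I_n]].

HB.instance Definition _ := Measurable.copy tessellation
  (g_sigma_algebraType cell_count_sets).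

End spaces.

Section splitting.
Context {R : realType} {d : nat}.
Local Notation V := 'rV[R]_d.+1.
Local Notation polytope := (polytope R d).
Local Notation hypersphere := (hypersphere R d).
Local Notation tessellation := (tessellation R d).
Implicit Types (c : polytope) (S : hypersphere) (T : tessellation).

Definition hits c : set hypersphere :=
  [set S | sval S `&` sinterior (sval c) !=set0].

Definition oslash_cells c S T : set polytope :=
  (sval T `\ c) `|`
  [set c' | exists2 h, half_sphere_of (sval S) h & sval c' = sval c `&` h].

Lemma polytope_sphere c : sval c `<=` sphere.
Proof. by have [_ [C _ ->]] := svalP c; by move=> x []. Qed.

Lemma sinteriorS (A B : set V) : A `<=` B -> sinterior A `<=` sinterior B.
Proof.
by move=> AB x [x1 Ax]; split=> //; apply: filterS Ax. Qed.

Lemma sinterior_sub (A : set V) : sinterior A `<=` A.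
Proof. by move=> x [x1 /nbhs_singleton]; exact. Qed.

Lemma hypersphere_normal S : exists2 u : V, u != 0 &
  sval S = [set x | sphere x /\ dot u x = 0].
Proof.
have [U /subspace_normal[u u0 uU] ->] := svalP S; exists u => //.
by apply/seteqP; split=> x /= [x1]; rewrite uU => /eqP.
Qed.

Lemma polytope_half c S h x : half_sphere_of (sval S) h ->
  sval S x -> sval c x -> exists c', sval c' = sval c `&` h.
Proof.
move=> [u [u0 SE hE]] Sx cx; suff P : nonempty_polytope (sval c `&` h).
  by exists (exist _ _ P).
split; first by exists x; split=> //; rewrite hE; move: Sx; rewrite SE => -[? ux]; rewrite /= ux.
have [_ [C [n [v [v0 ->]]] ->]] := svalP c; rewrite hE.
pose w (i : 'I_n.+1) := if unlift ord0 i is Some j then v j else u.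
exists [set y | forall i, 0 <= dot (w i) y].
  by exists n.+1, w; split=> // i; rewrite /w; case: unliftP.
apply/seteqP; split=> y /=.
  move=> [[y1 vy] [_ uy]]; split=> // i.
  by rewrite /w; case: unliftP => //= j _; exact: vy.
move=> [y1 wy]; split; last first.
  by split=> //; have := wy ord0; rewrite /w unlift_none.
by split=> // i; have := wy (lift ord0 i); rewrite /w liftK.
Qed.

Lemma oslash_tessellation c S T : sval T c -> hits c S ->
  is_tessellation (oslash_cells c S T).
Proof.
move=> Tc [e [Se ie]]; have [Tfin Tdim Tdisj Tcov] := svalP T.
have [u u0 SE] := hypersphere_normal S.
have Nu0 : - u != 0 by rewrite oppr_eq0.
have ue : dot u e = 0 by move: Se; rewrite SE => -[].
have ce := sinterior_sub ie.
pose H v : set V := [set x | sphere x /\ 0 <= dot v x].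
have half v : v != 0 -> sval S = [set x | sphere x /\ dot v x = 0] ->
    H v = H u \/ H v = H (- u).
  rewrite SE => v0 /(normal_uniq u0 v0)[a a0 ->].
  case: (ltgtP a 0) a0 => // aN _; [right|left]; rewrite /H;
    apply/seteqP; split=> x /= [x1]; rewrite ?dotNl dotZl; rewrite ?(pmulr_rge0 _ aN) ?(nmulr_rge0 _ aN) ?oppr_ge0;
    by split.
have SN : sval S = [set x | sphere x /\ dot (- u) x = 0].
  rewrite SE; apply/seteqP; split=> x /= [x1]; rewrite dotNl => /eqP;
  by rewrite ?oppr_eq0 => /eqP ux; split=> //; rewrite ?oppr_eq0 ux ?oppr0.
have hu : half_sphere_of (sval S) (H u) by exists u.
have hNu : half_sphere_of (sval S) (H (- u)) by exists (- u).
have sub c' : oslash_cells c S T c' -> ~ (sval T `\ c) c' ->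
    exists2 v, v != 0 /\ (v = u \/ v = - u) & sval c' = sval c `&` H v.
  case=> // -[h [v [v0 Sv ->]] c'E] _; rewrite -/(H v) in c'E.
  by have [E|E] := half v v0 Sv; [exists u|exists (- u)];
    rewrite -?E//; split=> //; [left|right].
have Hdisj v : v != 0 -> sinterior (sval c `&` H v) `&` sinterior (sval c `&` H (- v)) = set0.
  move=> v0; rewrite -subset0 => x [ix iNx].
  have : sinterior [set y | sphere y /\ dot v y = 0] x.
    case: ix iNx => x1 ix [_ iNx]; split=> //.
    apply: filterS2 ix iNx => y [_ [y1 vy]] [_ [_]].
    rewrite dotNl oppr_ge0 => vy'; split=> //.
    by apply/eqP; rewrite eq_le vy vy'.
  move=> ix'; have [_ vx] := sinterior_sub ix'.
  have [t t0 [xt0 [_ /eqP]]] := sint_normalize v ix'.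
  rewrite dotZr [X in _ * X]dotDr vx add0r [X in _ * X]dotZr !mulf_eq0 (gt_eqF t0) dot_eq0 (negbTE v0).
  by rewrite orbF invr_eq0 sqrtr_eq0 leNgt dot_gt0 xt0.
split.
- rewrite finite_setU; split; first exact: finite_setD.
  apply: (@sub_finite_set _ _ ((fun c' : polytope => sval c') @^-1`
      [set sval c `&` H u; sval c `&` H (- u)])).
    move=> c' [h [v [v0 Sv ->]] c'E] /=; rewrite -/(H v) in c'E.
    by rewrite c'E; case: (half v v0 Sv) => ->; [left|right].
  apply: finite_preimage; last exact: finite_set2.
  by move=> [A PA] [B PB] _ _ /= AB; exact: eq_exist.
- move=> c' Tc'; have [[/Tdim//]|nT] := pselect ((sval T `\ c) c').
  have [v [v0 vu] c'E] := sub _ Tc' nT; rewrite c'E.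
  have ve : dot v e = 0 by case: vu => ->; rewrite ?dotNl ue ?oppr0.
  apply: linear_hull_full => W AW w.
  have inW y : y != 0 -> sval c (normalize y) -> 0 <= dot v y -> y \in W.
    move=> y0 cy vy.
    have /AW/= : (sval c `&` H v) (normalize y).
      split=> //; split; first exact: normalize_sphere.
      by rewrite dotZr mulr_ge0// invr_ge0 sqrtr_ge0.
    move=> /(memvZ (Num.sqrt (dot y y))); rewrite scalerA divff ?scale1r//.
    by rewrite sqrtr_eq0 -ltNge dot_gt0.
  have eW : e \in W.
    have [t _ [e0 Ae]] := sint_normalize 0 ie.
    by rewrite scaler0 addr0 in e0 Ae; apply: inW => //; rewrite ve.
  have posW y : 0 <= dot v y -> y \in W.
    move=> vy; have [t t0 [xe0 Axe]] := sint_normalize y ie.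
    have : e + t *: y \in W.
      by apply: inW => //; rewrite dotDr dotZr ve add0r mulr_ge0// ltW.
    move=> /memvB/(_ eW); rewrite addrAC subrr add0r.
    by move=> /(memvZ t^-1); rewrite scalerA mulVf ?scale1r// gt_eqF.
  have [/posW//|vw] := leP 0 (dot v w).
  by rewrite -memvN posW// dotNr oppr_ge0 ltW.
- have self c1 c2 : sval T c1 -> c1 != c -> forall v, sval c2 = sval c `&` H v ->
      sinterior (sval c1) `&` sinterior (sval c2) !=set0 -> False.
    move=> T1 /eqP n1 v c2E [x [x1]]; rewrite c2E => x2; apply: n1.
    apply: Tdisj => //; exists x; split=> //.
    by apply: sinteriorS x2; exact: subIsetl.
  move=> c1 c2 H1 H2 H12.
  have [[T1 n1]|h1] := pselect ((sval T `\ c) c1);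
    have [[T2 n2]|h2] := pselect ((sval T `\ c) c2).
  + exact: Tdisj.
  + have [v _ c2E] := sub _ H2 h2.
    by case: (self c1 c2 T1 _ v c2E H12); exact/eqP.
  + have [v _ c1E] := sub _ H1 h1; rewrite setIC in H12.
    by case: (self c2 c1 T2 _ v c1E H12); exact/eqP.
  + have [v [v0 vu] c1E] := sub _ H1 h1; have [v' [_ vu'] c2E] := sub _ H2 h2.
    have [vv'|vv'] : v' = v \/ v' = - v.
      by case: vu vu' => -> [] ->; rewrite ?opprK; [left|right|right|left].
      rewrite vv' -c1E in c2E.
      by case: c1 c2 c2E {H1 H2 H12 h1 h2 c1E} => [A PA] [B PB] /= BA; apply: eq_exist.
    by move: H12; rewrite c1E c2E vv' Hdisj// => -[].
- rewrite -Tcov; apply/seteqP; split=> x.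
    move=> [c' [[Tc' _] c'x|[h _ c'E]]]; first by exists c'.
    by rewrite /= c'E => -[cx _]; exists c.
  move=> [c' Tc' c'x]; have [cc'|cc'] := pselect (c' = c); last first.
    by exists c' => //; left.
  rewrite cc' in c'x; have x1 := polytope_sphere c'x.
  have [ux|ux] := leP 0 (dot u x).
    have [c1 c1E] := polytope_half hu Se ce.
    by exists c1; [right; exists (H u)|rewrite /= c1E].
  have [c1 c1E] := polytope_half hNu Se ce.
  exists c1; first by right; exists (H (- u)).
  by rewrite /= c1E; split=> //; split=> //; rewrite dotNl oppr_ge0 ltW.
Qed.

(* The default value T is never used when c is a cell of T hit by S
   ([oslash_tessellation]). *)
Definition oslash c S T : tessellation :=
  if pselect (is_tessellation (oslash_cells c S T)) is left h
  then exist _ _ h else T.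

Lemma oslashE c S T : sval T c -> hits c S ->
  sval (oslash c S T) = oslash_cells c S T.
Proof.
move=> Tc cS; rewrite /oslash; case: pselect => // nh.
by case: nh; exact: oslash_tessellation.
Qed.

End splitting.

Section splitting_process.
Context {R : realType} {d : nat}.
Local Notation hypersphere := (hypersphere R d).
Local Notation tessellation := (tessellation R d).

Definition regular (kappa : set hypersphere -> \bar R) : Prop :=
  forall e : 'rV[R]_d.+1, sphere e ->
    kappa [set S : hypersphere | sval S e] = 0%E.

Definition splitting_generator (kappa : probability hypersphere R)
    (f : tessellation -> R) (T : tessellation) : R :=
  \sum_(c \in sval T) \int[kappa]_(S in hits c) (f (oslash c S T) - f T).

Definition transition_semigroup
    (p : R -> R.-pker tessellation ~> tessellation) : Prop :=
  (forall T (B : set tessellation), measurable B -> p 0 T B = \d_T B) /\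
  (forall (s t : R) T (B : set tessellation), 0 <= s -> 0 <= t -> measurable B ->
     p (s + t) T B = (\int[p s T]_T' p t T' B)%E).

(* A f is the derivative at 0 of t |-> p_t f, pointwise on the state space:
   the jump rates of the splitting process are unbounded in T, so that the
   limit is not uniform in T. *)
Definition semigroup_generator
    (p : R -> R.-pker tessellation ~> tessellation)
    (A : (tessellation -> R) -> tessellation -> R) : Prop :=
  forall f : tessellation -> R, measurable_fun setT f ->
    (exists M : R, forall T, `|f T| <= M) ->
    forall T, ((\int[p h T]_T' f T') - f T) / h @[h --> 0^'+] --> A f T.

Section process.
Context {dO : measure_display} {Omega : measurableType dO}.
Variables (P : probability Omega R) (Y : R -> Omega -> tessellation).

Definition past (s : R) : set (set Omega) :=
  <<s \bigcup_(u in `[0, s]) preimage_set_system setT (Y u) measurable >>.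

(* P(Y_(s+t) \in B | Y_u, u <= s) = p_t(Y_s, B). *)
Definition markov_with (p : R -> R.-pker tessellation ~> tessellation) : Prop :=
  forall (s t : R) (E : set Omega) (B : set tessellation),
    0 <= s -> 0 <= t -> past s E -> measurable B ->
    P (E `&` Y (s + t) @^-1` B) = (\int[P]_(w in E) p t (Y s w) B)%E.

(* Right-continuous and piecewise constant, with finitely many jumps in every
   bounded time interval. *)
Definition pure_jump_path (y : R -> tessellation) : Prop :=
  forall t, 0 <= t -> (\forall s \near t^'+, y s = y t) /\
    (0 < t -> exists T, \forall s \near t^'-, y s = T).

Definition splitting_process (kappa : probability hypersphere R) : Prop :=
  [/\ forall t, 0 <= t -> measurable_fun setT (Y t),
      {ae P, forall w, pure_jump_path (Y ^~ w)},
      {ae P, forall w, Y 0 w = tess0 R d} &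
      exists p, [/\ transition_semigroup p,
        semigroup_generator p (splitting_generator kappa) & markov_with p]].

End process.

End splitting_process.

Section poisson.
Context {R : realType} {d : nat}.
Local Notation V := 'rV[R]_d.+1.
Local Notation hypersphere := (hypersphere R d).
Local Notation tessellation := (tessellation R d).
Context {dO : measure_display} {Omega : measurableType dO}.

(* Poisson process with finite diffuse intensity measure mu, as a random set of
   points; the number of its points in B is |eta w /\ B|. The Poisson weights are
   spelled out because the library's [poisson_pmf r k] is 1 for all k at r = 0. *)
Definition poisson_process (P : probability Omega R)
    (mu : set hypersphere -> \bar R) (eta : Omega -> set hypersphere) : Prop :=
  let N B k := [set w | eta w `&` B #= `I_k] in
  let rate B := fine (mu B) in
  [/\ forall (B : set hypersphere) k, measurable B -> measurable (N B k),
      forall B k, measurable B ->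
        P (N B k) = (rate B ^+ k / k`!%:R * expR (- rate B))%:E &
      forall n (B : 'I_n -> set hypersphere) (k : 'I_n -> nat),
        (forall i, measurable (B i)) -> trivIset setT B ->
        fine (P (\bigcap_i N (B i) (k i))) = \prod_i fine (P (N (B i) (k i)))].

Definition hypersphere_cells (H : set hypersphere) : set (set V) :=
  let U := sphere `\` \bigcup_(S in H) sval S in
  [set closure (connected_component U x) | x in U].

Definition poisson_tessellation (P : probability Omega R)
    (kappa : probability hypersphere R) (t : R) (X : Omega -> tessellation) :
    Prop :=
  measurable_fun setT X /\
  exists2 eta, poisson_process P (fun B => t%:E * kappa B)%E eta &
    {ae P, forall w, [set sval c | c in sval (X w)] = hypersphere_cells (eta w)}.

Definition cell_intensity (P : probability Omega R) (X : Omega -> tessellation)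
    (B : set (polytope R d)) : \bar R :=
  (\int[P]_w \sum_(c \in sval (X w)) (\d_c B : \bar R))%E.

End poisson.

(* Main.v *)
Require Import Defs.
From HB Require Import structures.
From mathcomp Require Import finmap.
From mathcomp Require Import all_boot all_order all_algebra.
From mathcomp Require Import all_classical all_reals all_analysis.
From mathcomp Require Import measurable_realfun.
From mathcomp Require Import ring lra.

(* A full-dimensional polytope is determined by its points in a countable dense
   set D of the sphere, and on such polytopes the Borel sets of the Hausdorff
   distance are generated by the events {Q `<=` c}, Q a finite subset of D. So it
   suffices to compute the two intensities of cells containing a nonempty finite
   set Q; this also makes all masses finite, although the number of cells need
   not be bounded. By regularity no hypersphere passes through a point of Q, so
   at most one cell contains Q, and both intensities equal
   exp (- t * kappa (separating Q)). For the Poisson tessellation this is the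
   probability that no hypersphere of the process separates two points of Q. For
   the splitting process, the cell containing Q loses this property exactly when
   it is split by a hypersphere separating Q; since such hyperspheres all hit the
   cell, the indicator f of "some cell contains Q" satisfies
   A f = - kappa (separating Q) * f off a null set, and Kolmogorov's forward
   equation gives the exponential. The generator being only a pointwise limit,
   the forward equation rests on the domination
   1 - p_h (T, {T}) <= h * ncells T and on the bound e^t on the growth of the
   expected number of cells. *)

Set Implicit Arguments.
Unset Strict Implicit.
Unset Printing Implicit Defensive.

Import Order.TTheory GRing.Theory Num.Theory.
Import numFieldTopology.Exports numFieldNormedType.Exports.

Local Open Scope classical_set_scope.
Local Open Scope card_scope.
Local Open Scope ring_scope.

Local Notation edist := Defs.edist.

(** * Transition semigroups with a pointwise generator *)

(** The estimates on the semigroup could easily be circular. Passing from the generator to a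
    differential inequality needs an integrable bound on the difference quotients, naturally a
    multiple of [ncells]; the integrability of [ncells] must come from the generator too, which is
    given on bounded functions only. The truncations min([ncells], n) break the circle: their
    difference quotients are bounded above by a constant, so the growth estimate applies to them
    first, and monotone convergence gives the first moment. The generator at the indicator of a
    single tessellation controls the probability of staying there, which is why singletons have to
    be measurable. All differential inequalities are one-sided; the exponential is pinned down by
    applying the same upper estimate to an indicator and to its negative. That almost every
    tessellation has each given point in a single cell is obtained in the same way, from an
    inequality with rate 0 and initial value 0. *)

Section bounded_integrals.
Context d (X : measurableType d) (R : realType).
Variable mu : {measure set X -> \bar R}.
Hypothesis mu1 : mu setT = 1%E.
Implicit Types f g : X -> R.

Lemma unit_mass_fin_num E : measurable E -> mu E \is a fin_num.
Proof.
move=> mE; rewrite ge0_fin_numE// (@le_lt_trans _ _ (mu setT)) ?mu1 ?ltry//.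
by rewrite -mu1 le_measure ?inE.
Qed.

Lemma bounded_integrable f (M : R) :
  measurable_fun setT f -> (forall x, `|f x| <= M) ->
  mu.-integrable setT (EFin \o f).
Proof.
move=> mf fM; apply: measurable_bounded_integrable => //.
  by rewrite mu1 ltry.
exists M; split; first exact: num_real.
by move=> y My x _; exact: le_trans (fM x) (ltW My).
Qed.

Lemma Rintegral_cstT (r : R) : \int[mu]_x r = r.
Proof.
have : mu setT = 1%E by exact: mu1.
by rewrite Rintegral_cst// => ->; rewrite mulr1.
Qed.

Lemma Rintegral_shift f (M : R) :
  measurable_fun setT f -> (forall x, `|f x| <= M) ->
  (\int[mu]_x (f x + M)%:E)%E = (\int[mu]_x f x + M)%:E.
Proof.
move=> mf fM; have If := bounded_integrable mf fM.
have IM : mu.-integrable setT (EFin \o cst M).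
  by apply: (@bounded_integrable _ `|M|) => //; exact: measurable_cst.
rewrite integralD_EFin// EFinD; congr (_ + _)%E.
  by rewrite /Rintegral fineK//; exact: integrable_fin_num.
by rewrite integral_cst//= mu1 mule1.
Qed.

Lemma le_bounded_Rintegral f g (M N : R) :
  measurable_fun setT f -> (forall x, `|f x| <= M) ->
  measurable_fun setT g -> (forall x, `|g x| <= N) ->
  (forall x, f x <= g x) -> \int[mu]_x f x <= \int[mu]_x g x.
Proof.
move=> mf fM mg gN fg; apply: le_Rintegral => //.
  exact: bounded_integrable fM.
exact: bounded_integrable gN.
Qed.

Lemma normr_Rintegral_bounded f (M : R) :
  measurable_fun setT f -> (forall x, `|f x| <= M) -> `|\int[mu]_x f x| <= M.
Proof.
move=> mf fM; have := le_normr_Rintegral measurableT (bounded_integrable mf fM).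
move=> /le_trans; apply; rewrite -[leRHS](Rintegral_cstT M).
apply: (@le_bounded_Rintegral _ _ M `|M|) => //.
- exact: measurableT_comp.
- by move=> x; rewrite normr_id.
Qed.

(* The integrand need not be measurable: the library's integral is then a
   difference of lower integrals. *)
Lemma Rintegral_le_indic (D E : set X) f (b : R) :
  0 <= b -> measurable E -> (forall x, D x -> f x <= b * \1_E x) ->
  \int[mu]_(x in D) f x <= b * fine (mu E).
Proof.
move=> b0 mE fb; rewrite /Rintegral integralE.
set I1 := (X in (X - _)%E); set I2 := (X in (_ - X)%E).
have I2_ge0 : (0 <= I2)%E by apply: integral_ge0.
have muE : mu E = (fine (mu E))%:E by rewrite fineK// unit_mass_fin_num.
have I1_ge0 : (0 <= I1)%E by apply: integral_ge0.
have I1_le : (I1 <= (b * fine (mu E))%:E)%E.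
  rewrite EFinM -muE.
  have -> : (b%:E * mu E = \int[mu]_x (b * \1_E x)%:E)%E.
    under eq_integral do rewrite EFinM.
    rewrite ge0_integralZl//; last exact/measurable_EFinP.
    by rewrite integral_indic// setIT.
  rewrite /I1 !ge0_integralE//; last first.
    by move=> x _; rewrite lee_fin mulr_ge0.
  apply: le_ereal_sup => _ [h hf <-]; exists h => // x.
  apply: le_trans (hf x) _; rewrite patch_setT /patch; case: ifPn => [/[!inE] Dx|_].
    by rewrite funeposE /= ge_max !lee_fin fb// mulr_ge0.
  by rewrite lee_fin mulr_ge0.
have bE : 0 <= b * fine (mu E) by rewrite mulr_ge0// fine_ge0.
case: I1 I1_le I1_ge0 => [r|//|//]; rewrite !lee_fin => rb r0.
case: I2 I2_ge0 => [s|_ //=|//]; rewrite ?lee_fin //= => s0.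
by rewrite (le_trans _ rb)// gerBl.
Qed.

End bounded_integrals.

(** * Chapman-Kolmogorov for bounded functions *)

Section transition_functions.
Context d (X : measurableType d) (R : realType).
Variable p : R -> R.-pker X ~> X.
Hypothesis p0 : forall x (B : set X), measurable B -> p 0 x B = \d_x B.
Hypothesis pD : forall (s t : R) x (B : set X), 0 <= s -> 0 <= t -> measurable B ->
  p (s + t) x B = (\int[p s x]_y p t y B)%E.
Implicit Types f : X -> R.

Let p1 t x : p t x setT = 1%E. Proof. exact: prob_kernel. Qed.

Lemma measurable_kernel_Rintegral t f : measurable_fun setT f ->
  measurable_fun setT (fun x => \int[p t x]_y f y).
Proof.
move=> mf; rewrite /Rintegral; apply: measurableT_comp => //=.
have mEf : measurable_fun setT (EFin \o f) by exact/measurable_EFinP.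
under eq_fun do rewrite integralE.
apply: emeasurable_funB; apply: measurable_fun_integral_kernel => //.
- by move=> U mU; exact: measurable_kernel.
- exact: measurable_funepos.
- by move=> U mU; exact: measurable_kernel.
- exact: measurable_funeneg.
Qed.

Lemma ge0_chapman_kolmogorov s t x (f : X -> \bar R) : 0 <= s -> 0 <= t ->
  (forall y, 0 <= f y)%E -> measurable_fun setT f ->
  (\int[p (s + t) x]_z f z = \int[p s x]_y \int[p t y]_z f z)%E.
Proof.
move=> s0 t0 f0 mf.
rewrite -(integral_kcomp (p s) (kernel.kernel_snd (p t)))//.
by apply: eq_measure_integral => A mA _; rewrite pD.
Qed.

Lemma Rintegral_p0 x f : measurable_fun setT f -> \int[p 0 x]_y f y = f x.
Proof.
move=> mf; rewrite /Rintegral.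
rewrite (@eq_measure_integral _ _ _ setT (\d_x)) => [|A mA _]; last exact: p0.
by rewrite integral_dirac// ?diracT ?mul1e//; exact/measurable_EFinP.
Qed.

(** Reduced to nonnegative integrands by adding M; the shift cancels because every kernel has mass
    1. *)
Lemma chapman_kolmogorov s t x f (M : R) : 0 <= s -> 0 <= t ->
  measurable_fun setT f -> (forall y, `|f y| <= M) ->
  \int[p (s + t) x]_z f z = \int[p s x]_y \int[p t y]_z f z.
Proof.
move=> s0 t0 mf fM.
have := @ge0_chapman_kolmogorov s t x (fun y => (f y + M)%:E) s0 t0.
rewrite (Rintegral_shift (p1 _ _) mf fM).
under eq_integral do rewrite (Rintegral_shift (p1 _ _) mf fM).
rewrite (@Rintegral_shift _ _ _ _ (p1 _ _) (fun y => \int[p t y]_z f z) M).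
- move=> H; apply: (addIr M); apply: EFin_inj; apply: H.
    by move=> y; rewrite lee_fin -lerBlDr sub0r lerNl (le_trans _ (fM y))// -normrN ler_norm.
  by apply/measurable_EFinP; exact: measurable_funD.
- exact: measurable_kernel_Rintegral.
- by move=> y; apply: normr_Rintegral_bounded.
Qed.

End transition_functions.

(** * A monotonicity criterion by Dini derivatives *)

Section dini.
Context (R : realType).

Lemma bernoulli_ineq (x : R) n : -1 <= x -> 1 + n%:R * x <= (1 + x) ^+ n.
Proof.
move=> x1; elim: n => [|n IHn]; first by rewrite mul0r addr0 expr0.
rewrite exprS; apply: (@le_trans _ _ ((1 + x) * (1 + n%:R * x))).
  have : 0 <= n%:R * x ^+ 2 by rewrite mulr_ge0// sqr_ge0.
  by rewrite -natr1; lra.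
by rewrite ler_wpM2l//; lra.
Qed.

(** The hypotheses say that the upper right Dini derivative is at most 0 and that w has no upward
    jump from the left. Compare w with a line of small slope e' through (0, w 0): at the supremum m
    of the times up to which w stays below the line, the second hypothesis gives the bound at m
    itself, and the first carries it beyond m unless m = a. *)
Lemma le_of_right_dini (w : R -> R) (a : R) : 0 <= a ->
  (forall t : R, 0 <= t -> forall e : R, 0 < e -> exists2 r : R, 0 < r &
     forall h : R, 0 < h -> h < r -> w (t + h) <= w t + e * h) ->
  (forall t : R, 0 < t -> forall e : R, 0 < e -> exists2 r : R, 0 < r &
     forall s : R, 0 <= s -> s < t -> t - r < s -> w t <= w s + e) ->
  w a <= w 0.
Proof.
move=> a0 wr wl; apply/ler_addgt0Pr => /= e e0.
(* Then e' * a <= e; the summand 1 covers a = 0. *)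
pose e' : R := e / (a + 1).
have e'0 : 0 < e' by rewrite divr_gt0//; lra.
suff : w a <= w 0 + e' * a.
  move=> /le_trans; apply; rewrite lerD2l /e' mulrAC ler_pdivrMr; last lra.
  by rewrite ler_wpM2l//; lra.
pose S := [set s : R | 0 <= s <= a /\ forall r : R, 0 <= r <= s -> w r <= w 0 + e' * r].
have S0 : S 0.
  split; first by rewrite lexx.
  by move=> r /le_anti <-; rewrite mulr0 addr0.
have hsS : has_sup S by split; [exists 0|exists a => s [/andP[]]].
pose m := sup S.
have m0 : 0 <= m by apply: sup_ubound => //; case: hsS.
have ma : m <= a by apply: ge_sup => [|s [/andP[]//]]; exists 0.
have lt_m (r : R) : 0 <= r -> r < m -> w r <= w 0 + e' * r.
  move=> r0 rm; have rm0 : 0 < m - r by lra.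
  have [s [_ Ss] rs] := sup_adherent rm0 hsS.
  by apply: Ss; rewrite r0/=; rewrite -/m in rs; lra.
have wm : w m <= w 0 + e' * m.
  have [->|m_gt0] := eqVneq m 0; first by rewrite mulr0 addr0.
  have {}m_gt0 : 0 < m by rewrite lt_neqAle eq_sym m_gt0.
  apply/ler_addgt0Pr => /= b b0; have [r r0 H] := wl _ m_gt0 _ b0.
  pose s : R := Num.max 0 (m - r / 2).
  have s0 : 0 <= s by rewrite le_max lexx.
  have sm : s < m by rewrite /s gt_max; apply/andP; split => //; lra.
  have rs : m - r < s by rewrite /s lt_max; apply/orP; right; lra.
  have := H s s0 sm rs; have := lt_m s s0 sm.
  have : e' * s <= e' * m by rewrite ler_wpM2l ?ltW.
  lra.
have [am|{}ma] := leP a m; first by have -> : a = m by lra.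
have [r r0 H] := wr _ m0 _ e'0.
pose s : R := m + Num.min (r / 2) (a - m).
have ms : m < s by rewrite ltrDl lt_min; apply/andP; split; lra.
have sr : s - m < r.
  by rewrite /s addrAC subrr add0r gt_min; apply/orP; left; lra.
have sa : s <= a by rewrite /s -lerBrDl ge_min lexx orbT.
suff : S s by move=> /(sup_ubound (proj2 hsS)); rewrite -/m; lra.
split; first by rewrite sa andbT; lra.
move=> q /andP[q0 qs]; have [qm|mq] := ltP q m; first exact: lt_m.
have [->//|qm] := eqVneq q m.
have hq : 0 < q - m by rewrite subr_gt0 lt_neqAle eq_sym qm.
have := H (q - m) hq; rewrite (addrC m) subrK => H'.
have : q - m < r by lra.
move=> /H'; have -> : e' * (q - m) = e' * q - e' * m by ring.
lra.
Qed.

(** exp (-x) * (1 + x) lies between 1 - x^2 and 1; the sign of u decides which bound is used. With x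
    = k * h, the error made by an Euler step of the discounted expectation is quadratic in h. *)
Lemma expRN_mul1D_le (x u : R) : -1 <= x ->
  expR (- x) * (1 + x) * u <= u + `|u| * x ^+ 2.
Proof.
move=> x1.
have E1 : expR (- x) * (1 + x) <= 1.
  rewrite expRN mulrC ler_pdivrMr ?expR_gt0// mul1r.
  exact: expR_ge1Dx.
have E2 : 1 - x ^+ 2 <= expR (- x) * (1 + x).
  have -> : 1 - x ^+ 2 = (1 + - x) * (1 + x) by ring.
  by rewrite ler_wpM2r ?expR_ge1Dx//; lra.
have x2 : 0 <= x ^+ 2 by exact: sqr_ge0.
have [u0|u0] := leP 0 u.
  rewrite ger0_norm//; apply: (@le_trans _ _ (1 * u)).
    by rewrite ler_wpM2r.
  by rewrite mul1r lerDl mulr_ge0.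
rewrite ltr0_norm//; apply: (@le_trans _ _ ((1 - x ^+ 2) * u)).
  by rewrite ler_wnM2r// ltW.
by rewrite mulrBl mul1r lerD2l mulNr mulrC.
Qed.

End dini.

(** * Exponential growth bounds from the generator *)

Section semigroup_growth.
Context d (X : measurableType d) (R : realType).
Variable p : R -> R.-pker X ~> X.
Hypothesis p0 : forall x (B : set X), measurable B -> p 0 x B = \d_x B.
Hypothesis pD : forall (s t : R) x (B : set X), 0 <= s -> 0 <= t -> measurable B ->
  p (s + t) x B = (\int[p s x]_y p t y B)%E.
Variable A : (X -> R) -> X -> R.
Hypothesis pA : forall f : X -> R, measurable_fun setT f ->
  (exists M : R, forall x, `|f x| <= M) ->
  forall x, ((\int[p h x]_y f y) - f x) / h @[h --> 0^'+] --> A f x.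
Implicit Types f : X -> R.

Let p1 t x : p t x setT = 1%E. Proof. exact: prob_kernel. Qed.
Let mE t f : measurable_fun setT f -> measurable_fun setT (fun x => \int[p t x]_y f y).
Proof. exact: measurable_kernel_Rintegral. Qed.
Let CK := chapman_kolmogorov pD.

Lemma cvg_generator_seq f (M : R) (h_ : R^nat) x :
  measurable_fun setT f -> (forall y, `|f y| <= M) ->
  (forall n, 0 < h_ n) -> h_ @ \oo --> (0 : R) ->
  ((\int[p (h_ n) x]_y f y) - f x) / h_ n @[n --> \oo] --> A f x.
Proof.
move=> mf fM h0 hc; have /cvg_at_rightP := @pA f mf (ex_intro _ M fM) x.
by apply; split.
Qed.

(* The difference quotients of the semigroup converge to the generator only
   pointwise; G dominates them from above, uniformly in h. *)
Section growth.
Variables (f G : X -> R) (M k : R) (x0 : X).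
Hypotheses (mf : measurable_fun setT f) (fM : forall x, `|f x| <= M).
Hypotheses (mG : measurable_fun setT G) (G0 : forall x, 0 <= G x).
Hypothesis fG : forall (h : R) x, 0 <= h -> \int[p h x]_y f y - f x <= h * G x.
Hypothesis GC : forall a : R, 0 <= a -> exists C : R, forall t : R, 0 <= t -> t <= a ->
  (\int[p t x0]_y (G y)%:E <= C%:E)%E.
Hypothesis Afk : forall t : R, 0 <= t -> {ae p t x0, forall y, A f y <= k * f y}.

Let u (t : R) := \int[p t x0]_y f y.

Let M0 : 0 <= M. Proof. exact: le_trans (fM x0). Qed.

Let uM t : `|u t| <= M. Proof. exact: (normr_Rintegral_bounded (p1 _ _)). Qed.

Let EM h y : `|\int[p h y]_z f z| <= M.
Proof. exact: (normr_Rintegral_bounded (p1 _ _)). Qed.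

Let G_integrable (t : R) : 0 <= t -> (p t x0).-integrable setT (EFin \o G).
Proof.
move=> t0; apply/integrableP; split; first exact/measurable_EFinP.
have [C HC] := GC t0.
apply: (@le_lt_trans _ _ C%:E); last by rewrite ltry.
apply: le_trans (HC t t0 (lexx t)).
by rewrite le_eqVlt; apply/orP; left; apply/eqP/eq_integral => y _ /=;
  rewrite ger0_norm.
Qed.

Let f_integrable t : (p t x0).-integrable setT (EFin \o f).
Proof. exact: (bounded_integrable (p1 _ _) mf fM). Qed.

(** Excludes upward jumps of u from the left, as [le_of_right_dini] requires. *)
Let u_upper (s t C : R) : 0 <= s -> s <= t -> 0 <= C ->
  (\int[p s x0]_y (G y)%:E <= C%:E)%E -> u t <= u s + C * (t - s).
Proof.
move=> s0 st C0 HC; have ts0 : 0 <= t - s by rewrite subr_ge0.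
have -> : u t = \int[p s x0]_y \int[p (t - s) y]_z f z.
  by rewrite -(CK x0 s0 ts0 mf fM) /u addrC subrK.
have IG := G_integrable s0.
apply: (@le_trans _ _ (\int[p s x0]_y (f y + (t - s) * G y))).
  apply: le_Rintegral => //.
  - by apply: (bounded_integrable (p1 _ _) _ (EM _)); exact: mE.
  - exact: (integrableD measurableT (f_integrable s) (integrableZl measurableT _ IG)).
  - by move=> y _; rewrite -lerBlDl fG.
rewrite RintegralD//; last exact: (integrableZl measurableT _ IG).
rewrite RintegralZl// lerD2l mulrC ler_wpM2r//.
rewrite /Rintegral -lee_fin fineK//; exact: integrable_fin_num IG.
Qed.

(** The excess of the difference quotient over k * f. Its positive part is taken because [fG] bounds
    the quotient only from above, while dominated convergence needs a bound on both sides. *)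
Let psi (h : R) y : R := Num.max ((\int[p h y]_z f z - f y) / h - k * f y) 0.

Let mpsi h : measurable_fun setT (psi h).
Proof.
apply: measurable_maxr => //; apply: measurable_funB; last exact: measurable_funM.
by apply: measurable_funM => //; apply: measurable_funB => //; exact: mE.
Qed.

Let psi_ge0 h y : 0 <= psi h y. Proof. by rewrite le_max lexx orbT. Qed.

Let psi_le (h : R) y : 0 < h -> psi h y <= G y + `|k| * M.
Proof.
move=> h0; rewrite ge_max addr_ge0 ?mulr_ge0// andbT lerD//.
  by rewrite ler_pdivrMr// mulrC fG// ltW.
by rewrite -mulNr (le_trans (ler_norm _))// normrM normrN ler_wpM2l.
Qed.

Let psi_integrable (t h : R) : 0 <= t -> 0 < h ->
  (p t x0).-integrable setT (EFin \o psi h).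
Proof.
move=> t0 h0.
have IM : (p t x0).-integrable setT (EFin \o cst (`|k| * M)).
  apply: (@bounded_integrable _ _ _ _ (p1 _ _) _ (`|k| * M)) => [|x /=].
    exact: measurable_cst.
  by rewrite ger0_norm// mulr_ge0.
apply: le_integrable (integrableD measurableT (G_integrable t0) IM) => //.
  exact/measurable_EFinP.
move=> y _ /=; rewrite lee_fin ger0_norm// ger0_norm ?psi_le//.
by rewrite addr_ge0// mulr_ge0.
Qed.

Let psi_cvg (t : R) : 0 <= t -> \int[p t x0]_y psi h y @[h --> 0^'+] --> 0.
Proof.
move=> t0; apply/cvg_at_rightP => h_ [h0 hc].
have IM : (p t x0).-integrable setT (EFin \o cst (`|k| * M)).
  apply: (@bounded_integrable _ _ _ _ (p1 _ _) _ (`|k| * M)) => [|x /=].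
    exact: measurable_cst.
  by rewrite ger0_norm// mulr_ge0.
have [] := @dominated_convergence _ _ _ (p t x0) setT measurableT
  (fun n y => (psi (h_ n) y)%:E) (cst 0%E) (fun y => (G y + `|k| * M)%:E).
- by move=> n; exact/measurable_EFinP.
- exact: measurable_cst.
- have [N [mN N0 HN]] := Afk t0; exists N; split=> // y /= Hy; apply: HN => /= yA.
  apply: Hy => _; apply/cvg_EFin; first by near=> n.
  have -> : fine \o (fun n => (psi (h_ n) y)%:E) = fun n => psi (h_ n) y by [].
  have c1 : (\int[p (h_ n) y]_z f z - f y) / h_ n - k * f y @[n --> \oo]
      --> A f y - k * f y.
    by apply: cvgB; [exact: (cvg_generator_seq mf fM)|exact: cvg_cst].
  have -> : 0 = Num.max (A f y - k * f y) 0 :> R.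
    by apply/esym/max_idPr; rewrite subr_le0.
  (* In this form the limit follows from the continuity of the absolute value. *)
  have maxE (a : R) : Num.max a 0 = (a + `|a|) / 2 by rewrite maxr_absE subr0 addr0.
  rewrite maxE /psi; under eq_fun do rewrite maxE.
  by apply: cvgM; [apply: cvgD => //; exact: cvg_norm|exact: cvg_cst].
- exact: (integrableD measurableT (G_integrable t0) IM).
- by apply: aeW => y n _; rewrite lee_fin ger0_norm// psi_le.
move=> _ _; rewrite integral0 => H.
have -> : (fun n => \int[p t x0]_y psi (h_ n) y) =
    fine \o (fun n => \int[p t x0]_y (psi (h_ n) y)%:E)%E by [].
exact: fine_cvg H.
Unshelve. all: by end_near. Qed.

Let u_step (t h : R) : 0 <= t -> 0 < h ->
  u (t + h) <= u t + h * (k * u t + \int[p t x0]_y psi h y).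
Proof.
move=> t0 h0; have h0' := ltW h0.
have -> : u (t + h) = \int[p t x0]_y \int[p h y]_z f z.
  by rewrite -(CK x0 t0 h0' mf fM).
have I1 : (p t x0).-integrable setT (EFin \o psi h) by exact: psi_integrable.
have I2 : (p t x0).-integrable setT (fun y => (k * f y)%:E).
  exact: (integrableZl measurableT k (f_integrable t)).
have I3 : (p t x0).-integrable setT (fun y => (k * f y + psi h y)%:E).
  exact: (integrableD measurableT I2 I1).
have I4 : (p t x0).-integrable setT (fun y => (h * (k * f y + psi h y))%:E).
  exact: (integrableZl measurableT h I3).
have -> : u t + h * (k * u t + \int[p t x0]_y psi h y) =
    \int[p t x0]_y (f y + h * (k * f y + psi h y)).
  by rewrite RintegralD// RintegralZl// RintegralD// RintegralZl.
apply: le_Rintegral => //.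
- by apply: (bounded_integrable (p1 _ _) _ (EM _)); exact: mE.
- exact: (integrableD measurableT (f_integrable t) I4).
- move=> y _; rewrite -lerBlDl mulrC -ler_pdivrMr// -lerBlDl /psi.
  by rewrite le_max lexx.
Qed.

(** Gronwall's argument: exp (-k t) * u t satisfies the two hypotheses of [le_of_right_dini], the
    right one by [u_step] and [psi_cvg], the left one by [u_upper]. *)
Lemma expectation_le_expR (t : R) : 0 <= t -> u t <= expR (k * t) * f x0.
Proof.
move=> t0; pose w (t : R) : R := expR (- (k * t)) * u t.
suff : w t <= w 0.
  rewrite /w mulr0 oppr0 expR0 mul1r expRN mulrC ler_pdivrMr ?expR_gt0// mulrC.
  by rewrite /u (Rintegral_p0 p0).
apply: le_of_right_dini => // {}t {}t0 e e0.
- pose K := expR (- (k * t)); have K0 : 0 < K by exact: expR_gt0.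
  pose L := expR `|k|; have L0 : 0 < L by exact: expR_gt0.
  (* Half of e is spent on the integral of [psi], since K * L * e' = e / 2 with L bounding exp (-k
     h) for h <= 1; the other half on the quadratic error of [expRN_mul1D_le], by h < e / c. The
     third radius below gives h <= 1 and |k h| <= 1. *)
  pose e' := e / (2 * K * L); have e'0 : 0 < e' by rewrite !divr_gt0// !mulr_gt0.
  have /cvgrPdist_lt/(_ _ e'0)[r1 /= r10 Hr1] := psi_cvg t0.
  pose c := 2 * (K * (`|u t| * k ^+ 2) + 1).
  have c0 : 0 < c by rewrite mulr_gt0// ltr_wpDl// mulr_ge0 ?(ltW K0)// mulr_ge0// sqr_ge0.
  have k1 : 0 < `|k| + 1 by rewrite ltr_wpDl.
  exists (Num.min r1 (Num.min (e / c) (`|k| + 1)^-1)).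
    by rewrite !lt_min r10 divr_gt0//= invr_gt0.
  move=> h h0; rewrite !lt_min => /and3P[hr1 he hk].
  have h1 : h <= 1.
    by rewrite (le_trans (ltW hk))// invf_le1// lerDr.
  have kh1 : `|k * h| <= 1.
    have : h * (`|k| + 1) < 1 by rewrite -ltr_pdivlMr// div1r.
    by rewrite normrM (gtr0_norm h0); lra.
  have psih : \int[p t x0]_y psi h y < e'.
    have := Hr1 h; rewrite /= !sub0r !normrN (gtr0_norm h0) => /(_ hr1 h0).
    by apply: le_lt_trans; exact: ler_norm.
  have := u_step t0 h0.
  set I := \int[p t x0]_y psi h y in psih * => us.
  have -> : w (t + h) = K * (expR (- (k * h)) * u (t + h)).
    by rewrite /w mulrDr opprD expRD mulrA.
  apply: (@le_trans _ _ (K * (expR (- (k * h)) * (1 + k * h) * u t + L * h * e'))).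
    rewrite ler_wpM2l ?(ltW K0)//.
    apply: (@le_trans _ _ (expR (- (k * h)) * (u t + h * (k * u t + I)))).
      by rewrite ler_wpM2l// expR_ge0.
    have -> : expR (- (k * h)) * (u t + h * (k * u t + I)) =
      expR (- (k * h)) * (1 + k * h) * u t + expR (- (k * h)) * h * I by ring.
    rewrite lerD2l; apply: (@le_trans _ _ (expR (- (k * h)) * h * e')).
      by rewrite ler_wpM2l ?(ltW psih)// mulr_ge0 ?expR_ge0 ?ltW.
    rewrite ler_wpM2r ?(ltW e'0)// ler_wpM2r ?(ltW h0)// ler_expR.
    rewrite (le_trans (ler_norm _))// normrN normrM (gtr0_norm h0).
    by rewrite ler_piMr.
  have kh : -1 <= k * h by move: kh1; rewrite ler_norml => /andP[].
  have := expRN_mul1D_le (u t) kh => E.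
  apply: (@le_trans _ _ (K * (u t + `|u t| * (k * h) ^+ 2 + L * h * e'))).
    by rewrite ler_wpM2l ?(ltW K0)// lerD2r.
  have -> : w t = K * u t by [].
  have -> : K * (u t + `|u t| * (k * h) ^+ 2 + L * h * e') =
    K * u t + h * (K * (`|u t| * k ^+ 2) * h + K * L * e') by ring.
  rewrite lerD2l mulrC ler_wpM2r ?(ltW h0)//.
  have -> : K * L * e' = e / 2 by rewrite /e'; field; rewrite !gt_eqF.
  have : c * h < e by rewrite mulrC -ltr_pdivlMr.
  rewrite /c mulrDr mulr1 mulrDl => ch.
  have : 2 * (K * (`|u t| * k ^+ 2)) * h = 2 * (K * (`|u t| * k ^+ 2) * h) by ring.
  by lra.
- have [C HC] := GC (ltW t0).
  have C0 : 0 <= C.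
    rewrite -lee_fin; apply: le_trans (HC t (ltW t0) (lexx t)).
    by apply: integral_ge0 => y _; rewrite lee_fin.
  (* A bound on w t - w s: the first term is the possible increase of u between s and t, the second
     the change of the exponential factor. *)
  pose b (s : R) : R := expR (- (k * t)) * C * (t - s) + `|expR (- (k * t)) - expR (- (k * s))| * M.
  have bc : b s @[s --> t] --> 0.
    have -> : 0 = b t by rewrite /b !subrr mulr0 normr0 mul0r addr0.
    apply: cvgD.
      by apply: cvgM; [exact: cvg_cst|apply: cvgB; [exact: cvg_cst|exact: cvg_id]].
    apply: cvgM; last exact: cvg_cst.
    apply: cvg_norm; apply: cvgB; first exact: cvg_cst.
    apply: (cvg_comp _ expR); last exact: continuous_expR.
    by apply: cvgN; apply: cvgM; [exact: cvg_cst|exact: cvg_id].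
  have /cvgrPdist_lt/(_ _ e0)[r /= r0 Hr] := bc.
  exists r => // s s0 st tr.
  have bs : b s < e.
    have := Hr s; rewrite /= sub0r normrN gtr0_norm ?subr_gt0//.
    by move=> /(_ ltac:(lra)); apply: le_lt_trans; exact: ler_norm.
  suff : w t <= w s + b s by lra.
  have ut := u_upper s0 (ltW st) C0 (HC s s0 (ltW st)).
  have : expR (- (k * t)) * u t <= expR (- (k * t)) * (u s + C * (t - s)).
    by rewrite ler_wpM2l// expR_ge0.
  have : (expR (- (k * t)) - expR (- (k * s))) * u s <=
      `|expR (- (k * t)) - expR (- (k * s))| * M.
    by rewrite (le_trans (ler_norm _))// normrM ler_wpM2l.
  rewrite /w /b mulrBl mulrDr mulrA; lra.
Qed.

End growth.

(** N stands for the number of cells. [A_singleton] bounds the rate of leaving x by N x. [A_trunc]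
    expresses that a jump increases N by at most one; it is stated for truncations because [pA]
    covers bounded functions only. *)
Variable N : X -> nat.
Hypothesis mN : measurable_fun setT (fun x => (N x)%:R : R).
Hypothesis m1 : forall x : X, measurable [set x].
Hypothesis A_singleton : forall x, - (N x)%:R <= A (\1_[set x]) x.
Hypothesis A_trunc : forall n x,
  A (fun y => (minn (N y) n)%:R) x <= (minn (N x) n)%:R.

(* By supermultiplicativity of h |-> p h x [set x], its derivative at 0 bounds it
   from below for all h. *)
Lemma stay_probability_ge (h : R) x : 0 <= h ->
  1 - (N x)%:R * h <= fine (p h x [set x]).
Proof.
pose q h := fine (p h x [set x]).
have pE t y : p t y [set x] = (fine (p t y [set x]))%:E.
  by rewrite fineK// unit_mass_fin_num.
have q0 t : 0 <= q t by rewrite fine_ge0.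
have qD s t : 0 <= s -> 0 <= t -> q s * q t <= q (s + t).
  move=> s0 t0; rewrite -lee_fin /q -[leRHS]pE pD// EFinM -!pE.
  have -> : (p s x [set x] * p t x [set x] =
    \int[p s x]_(y in [set x]) p t y [set x])%E.
    rewrite (eq_integral (cst (p t x [set x]))) => [|y /[!inE] -> //].
    by rewrite integral_cst// muleC.
  by apply: ge0_subset_integral => //; exact: measurable_kernel.
have qn (s : R) n : 0 <= s -> q s ^+ n <= q (n%:R * s).
  move=> s0; elim: n => [|n IHn]; first by rewrite mul0r /q p0// diracE mem_set.
  rewrite exprS -natr1 mulrDl mul1r addrC; apply: le_trans (qD _ _ _ _) => //.
    by rewrite ler_wpM2l.
  by rewrite mulr_ge0.
rewrite le_eqVlt => /predU1P[<-|h0].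
  by rewrite mulr0 subr0 p0// diracE mem_set.
apply/ler_addgt0Pr => /= e e0.
have m1x : measurable_fun setT (\1_[set x] : X -> R) by exact: measurable_indic.
have b1x : exists M : R, forall y, `|\1_[set x] y : R| <= M.
  by exists 1 => y; rewrite ger0_norm// indicE lern1 leq_b1.
have eh0 : 0 < e / h by rewrite divr_gt0.
have /cvgrPdist_lt/(_ _ eh0)[r /= r0 Hr] := @pA _ m1x b1x x.
pose c := (N x)%:R + e / h.
have qc s : 0 < s -> s < r -> 1 - c * s <= q s.
  move=> s0 sr; have := Hr s; rewrite /= sub0r normrN (gtr0_norm s0) => /(_ sr s0).
  rewrite indicE mem_set//= /Rintegral.
  rewrite (_ : \int[p s x]_y _ = p s x [set x])%E; last first.
    by rewrite -[in RHS](setIT [set x]) -integral_indic.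
  rewrite -/(q s) ltr_norml => /andP[_ H].
  have : - c <= (q s - 1) / s by have := A_singleton x; rewrite /c; lra.
  by rewrite ler_pdivlMr//; lra.
(* Large enough for h / n < r, so that [qc] applies to one of n equal steps, and for c * h / n <= 1,
   so that Bernoulli's inequality applies. The total loss is c * h = N x * h + e. *)
pose n := (Num.truncn (h / r + c * h)).+1.
have n_gt : h / r + c * h < n%:R by rewrite truncnS_gt.
have c0 : 0 < c by rewrite ltr_wpDl.
have ch0 : 0 < c * h by rewrite mulr_gt0.
have hr0 : 0 < h / r by rewrite divr_gt0.
have n0 : 0 < n%:R :> R by rewrite ltr0n.
have s0 : 0 < h / n%:R by rewrite divr_gt0.
have sr : h / n%:R < r by rewrite ltr_pdivrMr// mulrC -ltr_pdivrMr//; lra.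
have cs : c * (h / n%:R) <= 1 by rewrite mulrA ler_pdivrMr// mul1r; lra.
have := qn _ n (ltW s0); rewrite mulrCA divff ?gt_eqF// mulr1 => qh.
have le1 : - 1 <= - (c * (h / n%:R)) by lra.
have := bernoulli_ineq n le1;
  rewrite mulrN mulrCA mulrC [n%:R * _]mulrCA divff ?gt_eqF// mulr1 => B.
have : (1 - c * (h / n%:R)) ^+ n <= q (h / n%:R) ^+ n.
  by rewrite lerXn2r ?nnegrE ?subr_ge0// qc.
have -> : fine (p h x [set x]) = q h by [].
have : c * h = (N x)%:R * h + e by rewrite /c mulrDl divfK ?gt_eqF.
by move: B; rewrite [h * c]mulrC; lra.
Qed.

(** f changes only if x is left, with probability at most N x * h, and then by at most 2 M. This
    supplies the dominating function of the growth estimate. *)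
Lemma expectation_increment_le f (M h : R) x : measurable_fun setT f ->
  (forall y, `|f y| <= M) -> 0 <= h ->
  \int[p h x]_y f y - f x <= h * (2 * M * (N x)%:R).
Proof.
move=> mf fM h0; have M0 : 0 <= M by exact: le_trans (fM x).
have stay := stay_probability_ge x h0.
have I1 : (p h x).-integrable setT (fun y => (f y)%:E).
  exact: (bounded_integrable (p1 _ _) mf fM).
have I0 : (p h x).-integrable setT (fun=> (f x)%:E).
  by apply: (@bounded_integrable _ _ _ _ (p1 _ _) (cst (f x)) `|f x|) => //;
    exact: measurable_cst.
have mC : measurable (~` [set x]) by exact: measurableC.
have I2 : (p h x).-integrable setT (fun y => (2 * M * \1_(~` [set x]) y)%:E).
  apply: (@bounded_integrable _ _ _ _ (p1 _ _) _ (2 * M)) => [|y].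
    by apply: measurable_funM => //; exact: measurable_indic.
  rewrite indicE normrM ger0_norm ?mulr_ge0// ler_piMr ?mulr_ge0//.
  by rewrite ger0_norm// lern1 leq_b1.
have I3 : (p h x).-integrable setT (fun y => (\1_(~` [set x]) y)%:E).
  apply: (@bounded_integrable _ _ _ _ (p1 _ _) _ 1) => [|y].
    exact: measurable_indic.
  by rewrite indicE ger0_norm// lern1 leq_b1.
have -> : \int[p h x]_y f y - f x = \int[p h x]_y (f y - f x).
  by rewrite RintegralB// ?Rintegral_cstT.
apply: (@le_trans _ _ (\int[p h x]_y (2 * M * \1_(~` [set x]) y))).
  apply: le_Rintegral => //.
    exact: (integrableB measurableT I1 I0).
  move=> y _; rewrite indicE; case: (boolP (y \in _)) => [_|].
    have := fM y; have := fM x; rewrite !ler_norml mulr1; lra.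
  by rewrite notin_setE /= => /contrapT ->; rewrite subrr mulr0.
rewrite RintegralZl// /Rintegral integral_indic// setIT.
have -> : fine (p h x (~` [set x])) = 1 - fine (p h x [set x]).
  have : (p h x [set x] + p h x (~` [set x]) = 1)%E.
    by rewrite -(p1 h x) -(setUv [set x]) measureU// setICr.
  rewrite -[X in (X + _)%E]fineK ?unit_mass_fin_num// -[X in (_ + X)%E]fineK ?unit_mass_fin_num//.
  by rewrite -EFinD => -[E]; rewrite -E addrC addKr.
by rewrite mulrCA ler_wpM2l ?mulr_ge0//; lra.
Qed.

(** For the truncation at n a constant dominates: where N >= n its expectation cannot increase, and
    where N < n the bound of [expectation_increment_le] is at most 2 n * n * h. *)
Lemma first_moment_le (t : R) x : 0 <= t ->
  (\int[p t x]_y (N y)%:R%:E <= (expR t * (N x)%:R)%:E)%E.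
Proof.
move=> t0.
pose f n y : R := (minn (N y) n)%:R.
have fE n y : f n y = Num.min (N y)%:R n%:R by rewrite /f natr_min.
have mf n : measurable_fun setT (f n).
  by rewrite (funext (fE n)); exact: measurable_minr.
have f0 n y : 0 <= f n y by [].
have fM n y : `|f n y| <= n%:R by rewrite ger0_norm// ler_nat geq_minr.
have bound n : (\int[p t x]_y (f n y)%:E <= (expR t * (N x)%:R)%:E)%E.
  have If : (p t x).-integrable setT (EFin \o f n).
    exact: (bounded_integrable (p1 _ _) (mf n) (fM n)).
  rewrite -[leLHS]fineK ?(integrable_fin_num measurableT If)// lee_fin.
  apply: (@le_trans _ _ (expR (1 * t) * f n x)); last first.
    by rewrite mul1r ler_wpM2l ?expR_ge0// ler_nat geq_minl.
  apply: (@expectation_le_expR (f n) (cst (2 * n%:R * n%:R)) n%:R 1 x) => //.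
  - by move=> y /=; rewrite !mulr_ge0.
  - move=> h y h0; have [nN|Nn] := leqP n (N y).
      have -> : f n y = n%:R by rewrite /f (minn_idPr nN).
      rewrite (@le_trans _ _ 0) ?mulr_ge0// subr_le0.
      apply: le_trans (ler_norm _) _.
      exact: (normr_Rintegral_bounded (p1 _ _) (mf n) (fM n)).
    apply: le_trans (expectation_increment_le y (mf n) (fM n) h0) _.
    by rewrite ler_wpM2l// ler_wpM2l ?mulr_ge0// ler_nat ltnW.
  - move=> a a0; exists (2 * n%:R * n%:R) => s s0 sa.
    rewrite (eq_integral (cst (2 * n%:R * n%:R)%:E))// integral_cst//.
    by rewrite [X in (_ * X)%E]p1 mule1.
  - by move=> s s0; apply: aeW => y; rewrite mul1r; exact: A_trunc.
have -> : (\int[p t x]_y (N y)%:R%:E)%E = limn (fun n => \int[p t x]_y (f n y)%:E)%E.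
  rewrite -monotone_convergence//.
  - apply: eq_integral => y _; apply/esym/cvg_lim => //.
    apply: cvg_near_cst; near=> n; congr (_%:E); rewrite /f (minn_idPl _)//.
    by near: n; exact: nbhs_infty_ge.
  - by move=> n; exact/measurable_EFinP.
  - by move=> n y _; rewrite lee_fin.
  - move=> y _ m n mn; rewrite lee_fin ler_nat leq_min geq_minl/=.
    by rewrite (leq_trans _ mn)// geq_minr.
apply: lime_le; last by apply: nearW.
apply: ereal_nondecreasing_is_cvgn => m n mn; apply: ge0_le_integral => //.
- by move=> y _; rewrite lee_fin.
- exact/measurable_EFinP.
- exact/measurable_EFinP.
- move=> y _; rewrite lee_fin ler_nat leq_min geq_minl/=.
  by rewrite (leq_trans _ mn)// geq_minr.
Unshelve. all: by end_near. Qed.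

Lemma generator_growth f (M k : R) x : measurable_fun setT f ->
  (forall y, `|f y| <= M) ->
  (forall t, 0 <= t -> {ae p t x, forall y, A f y <= k * f y}) ->
  forall t, 0 <= t -> \int[p t x]_y f y <= expR (k * t) * f x.
Proof.
move=> mf fM Afk t t0; have M0 : 0 <= M by exact: le_trans (fM x).
apply: (@expectation_le_expR f (fun y => 2 * M * (N y)%:R) M k x) => //.
- exact: measurable_funM.
- by move=> y; rewrite !mulr_ge0.
- by move=> h y; exact: expectation_increment_le.
- move=> a a0; exists (2 * M * (expR a * (N x)%:R)) => s s0 sa.
  under eq_integral do rewrite EFinM.
  rewrite ge0_integralZl//; last 2 first.
  - exact/measurable_EFinP.
  - by rewrite lee_fin mulr_ge0.
  rewrite (EFinM (2 * M)) lee_wpmul2l ?lee_fin ?mulr_ge0//.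
  apply: le_trans (first_moment_le x s0) _.
  by rewrite lee_fin ler_wpM2r// ler_expR.
Qed.

End semigroup_growth.
(** * Spherical polytopes and great hyperspheres *)

Section euclidean.
Context {R : realType} {d : nat}.
Local Notation V := 'rV[R]_d.+1.
Implicit Types (u v w x y z : V) (A B : set V).

Lemma dotx0 x : dot x 0 = 0.
Proof. by rewrite -[in LHS](scale0r 0) dotZr mul0r. Qed.

Lemma dot0x x : dot 0 x = 0.
Proof. by rewrite dotC dotx0. Qed.

Definition enorm x : R := Num.sqrt (dot x x).

Lemma enorm_ge0 x : 0 <= enorm x. Proof. exact: sqrtr_ge0. Qed.

Lemma sqr_enorm x : enorm x ^+ 2 = dot x x.
Proof. by rewrite sqr_sqrtr// dot_ge0. Qed.

Lemma enorm_gt0 x : (0 < enorm x) = (x != 0).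
Proof. by rewrite sqrtr_gt0 dot_gt0. Qed.

Lemma sphere_enorm x : sphere x -> enorm x = 1.
Proof. by rewrite /sphere /enorm /= => ->; rewrite sqrtr1. Qed.

Lemma enormZ a x : enorm (a *: x) = `|a| * enorm x.
Proof.
by rewrite /enorm dotZl dotZr mulrA -expr2 sqrtrM ?sqr_ge0// sqrtr_sqr.
Qed.

Lemma enormN x : enorm (- x) = enorm x.
Proof. by rewrite -scaleN1r enormZ normrN1 mul1r. Qed.

Lemma edistE x y : edist x y = enorm (x - y). Proof. by []. Qed.

Lemma cauchy_schwarz x y : `|dot x y| <= enorm x * enorm y.
Proof.
rewrite -ler_sqr ?nnegrE ?mulr_ge0 ?enorm_ge0//.
rewrite real_normK ?num_real// exprMn !sqr_enorm.
have [->|y0] := eqVneq y 0.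
  by rewrite !dotx0 expr0n mulr0.
have yy : 0 < dot y y by rewrite dot_gt0.
pose z := dot y y *: x - dot x y *: y.
have : 0 <= dot z z by exact: dot_ge0.
have -> : dot z z = dot y y * (dot x x * dot y y - dot x y ^+ 2).
  rewrite /z dotDl !dotDr !dotNl !dotNr !dotZl !dotZr (dotC y x); ring.
by rewrite pmulr_rge0// subr_ge0.
Qed.

Lemma enormD x y : enorm (x + y) <= enorm x + enorm y.
Proof.
rewrite -ler_sqr ?nnegrE ?addr_ge0 ?enorm_ge0// sqrrD !sqr_enorm.
rewrite dotDl !dotDr (dotC y x).
have := le_trans (ler_norm _) (cauchy_schwarz x y).
rewrite mulr2n; lra.
Qed.

Lemma edistC x y : edist x y = edist y x.
Proof. by rewrite !edistE -enormN opprB. Qed.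

Lemma edist_ge0 x y : 0 <= edist x y. Proof. exact: enorm_ge0. Qed.

Lemma edist_triangle y x z : edist x z <= edist x y + edist y z.
Proof.
by rewrite !edistE (le_trans _ (enormD _ _))// addrA subrK.
Qed.

Lemma dot_edist u x y : `|dot u x - dot u y| <= enorm u * edist x y.
Proof. by rewrite -dotNr -dotDr cauchy_schwarz. Qed.

Lemma edist_sphere x y : sphere x -> sphere y -> edist x y <= 2.
Proof.
move=> x1 y1; rewrite edistE (le_trans (enormD _ _))// enormN !sphere_enorm//.
Qed.

Lemma dot_sphere_le1 u x : sphere x -> `|dot u x| <= enorm u.
Proof. by move=> x1;
  rewrite (le_trans (cauchy_schwarz _ _))// (sphere_enorm x1) mulr1. Qed.

Lemma enorm_normalize x : x != 0 -> dot x (normalize x) = enorm x.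
Proof.
move=> x0; have e0 : enorm x != 0 by rewrite gt_eqF// enorm_gt0.
by rewrite dotZr -/(enorm x) -sqr_enorm expr2 mulrA mulVf// mul1r.
Qed.

(** The radial move from v to the sphere has length |1 - enorm v|, at most the distance from v to x;
    hence the factor 2. *)
Lemma edist_normalize x v : sphere x -> edist x v < 1 ->
  v != 0 /\ edist x (normalize v) <= 2 * edist x v.
Proof.
move=> x1 xv.
have xE : enorm x <= edist x v + enorm v.
  by rewrite edistE (le_trans _ (enormD _ _))// subrK.
have vE : enorm v <= edist x v + enorm x.
  by rewrite edistC edistE (le_trans _ (enormD _ _))// subrK.
rewrite (sphere_enorm x1) in xE vE.
have v0 : 0 < enorm v by lra.
split; first by rewrite -enorm_gt0.
rewrite (le_trans (edist_triangle v _ _))// mulr_natl mulr2n lerD2l.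
rewrite edistE /normalize -/(enorm v) -{1}(scale1r v) -scalerBl enormZ.
rewrite -{2}(gtr0_norm v0) -normrM mulrBl mul1r mulVf ?gt_eqF//.
by rewrite ler_norml; apply/andP; split; lra.
Qed.

Lemma coord_edist x y i : `|x 0 i - y 0 i| <= edist x y.
Proof.
rewrite -sqrtr_sqr ler_sqrt ?dot_ge0// /dot (bigD1 i)//= !mxE -expr2 lerDl.
by apply: sumr_ge0 => j _; rewrite -expr2 sqr_ge0.
Qed.

Lemma edist_coord x y (e : R) : (forall i, `|x 0 i - y 0 i| <= e) ->
  edist x y <= d.+1%:R * e.
Proof.
move=> xy; have e0 : 0 <= e by exact: le_trans (xy ord0).
rewrite -[leRHS]ger0_norm ?mulr_ge0// -sqrtr_sqr ler_wsqrtr//.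
have : dot (x - y) (x - y) <= \sum_(i < d.+1) e ^+ 2.
  apply: ler_sum => i _; rewrite !mxE -expr2 -real_normK ?num_real//.
  by rewrite ler_sqr ?nnegrE.
move=> /le_trans; apply; rewrite sumr_const card_ord exprMn -[leLHS]mulr_natl.
by rewrite ler_wpM2r ?sqr_ge0// -natrX ler_nat leq_pmulr.
Qed.

(** The topology of row vectors is that of the maximum norm, which the Euclidean norm dominates and
    exceeds by at most the crude factor d + 1. *)
Lemma nbhs_edistP x A :
  nbhs x A <-> exists2 e : R, 0 < e & forall y, edist x y < e -> A y.
Proof.
split=> [/nbhs_ballP[e /= e0 He]|[e e0 He]].
  exists e => // y xy; apply: He; split=> // i j.
  by rewrite /ball /= (ord1 i) (le_lt_trans (coord_edist _ _ _)).
(* Dividing by d + 2 instead of d + 1 keeps the inequality strict. *)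
apply/nbhs_ballP; exists (e / d.+2%:R) => /=; first by rewrite divr_gt0.
move=> y xy; apply: He.
apply: (@le_lt_trans _ _ (d.+1%:R * (e / d.+2%:R))).
  by apply: edist_coord => i; apply: ltW; exact: (proj2 xy).
rewrite mulrA ltr_pdivrMr// mulrC ltr_pM2l// ltr_nat//.
Qed.

(** On the sphere all distances are at most 2, so the suprema in [hausdorff_dist] are over bounded
    sets and are true upper bounds. *)
Lemma hausdorff_dist_lt A B (e : R) : A `<=` sphere -> B `<=` sphere ->
  A !=set0 -> B !=set0 -> hausdorff_dist A B < e ->
  (forall x, A x -> exists2 y, B y & edist x y < e) /\
  (forall y, B y -> exists2 x, A x & edist x y < e).
Proof.
move=> As Bs [a Aa] [b Bb]; rewrite gt_max => /andP[AB BA]; split.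
  move=> x Ax; have hi : has_inf [set edist x y | y in B].
    split; first by exists (edist x b); exists b.
    by exists 0 => _ [y _ <-]; exact: edist_ge0.
  have : inf [set edist x y | y in B] < e.
    apply: le_lt_trans AB; apply: ub_le_sup; last by exists x.
    exists 2 => _ [z Az <-]; apply: (@le_trans _ _ (edist z b)).
      apply: ge_inf; last by exists b.
      by exists 0 => _ [y _ <-]; exact: edist_ge0.
    by apply: edist_sphere; [exact: As|exact: Bs].
  by move=> /(inf_lt (proj1 hi))[_ [y By <-] ye]; exists y.
move=> y By; have hi : has_inf [set edist x y | x in A].
  split; first by exists (edist a y); exists a.
  by exists 0 => _ [x _ <-]; exact: edist_ge0.
have : inf [set edist x y | x in A] < e.
  apply: le_lt_trans BA; apply: ub_le_sup; last by exists y.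
  exists 2 => _ [z Bz <-]; apply: (@le_trans _ _ (edist a z)).
    apply: ge_inf; last by exists a.
    by exists 0 => _ [x _ <-]; exact: edist_ge0.
  by apply: edist_sphere; [exact: As|exact: Bs].
by move=> /(inf_lt (proj1 hi))[_ [x Ax <-] xe]; exists x.
Qed.

Lemma hausdorff_dist_le A B (r : R) : A !=set0 -> B !=set0 ->
  (forall x, A x -> forall e : R, 0 < e -> exists2 y, B y & edist x y <= r + e) ->
  (forall y, B y -> forall e : R, 0 < e -> exists2 x, A x & edist x y <= r + e) ->
  hausdorff_dist A B <= r.
Proof.
move=> [a Aa] [b Bb] AB BA; rewrite ge_max; apply/andP; split.
  apply: ge_sup; first by eexists; exists a.
  move=> _ [x Ax <-]; apply/ler_addgt0Pr => /= e e0.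
  have [y By xy] := AB x Ax e e0; apply: le_trans xy; apply: ge_inf; last by exists y.
  by exists 0 => _ [z _ <-]; exact: edist_ge0.
apply: ge_sup; first by eexists; exists b.
move=> _ [y By <-]; apply/ler_addgt0Pr => /= e e0.
have [x Ax xy] := BA y By e e0; apply: le_trans xy; apply: ge_inf; last by exists x.
by exists 0 => _ [z _ <-]; exact: edist_ge0.
Qed.

End euclidean.

(** * Measurable sets of polytopes and of great hyperspheres *)

Section polytope_geometry.
Context {R : realType} {d : nat}.
Local Notation V := 'rV[R]_d.+1.
Local Notation polytope := (polytope R d).
Local Notation hypersphere := (hypersphere R d).
Implicit Types (u v x y z : V) (c : polytope) (S : hypersphere).

Lemma polytope_inj c c' : sval c = sval c' -> c = c'.
Proof. by case: c c' => [A PA] [B PB] /= AB; exact: eq_exist. Qed.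

Lemma polytope_nonempty c : sval c !=set0.
Proof. by case: (svalP c). Qed.

Lemma polytopeP c : exists n (u : 'I_n -> V), (forall i, u i != 0) /\
  sval c = [set x | sphere x /\ forall i, 0 <= dot (u i) x].
Proof.
have [_ [C [n [u [u0 ->]]] ->]] := svalP c; exists n, u; split=> //.
Qed.

(** A half-space inequality violated at x stays violated within distance - dot u x / enorm u. This
    makes missing a point, or differing from a given polytope, an open condition in the Hausdorff
    distance. *)
Lemma polytope_far c x : ~ sval c x ->
  exists2 e : R, 0 < e & forall y, sval c y -> sphere x -> e <= edist x y.
Proof.
have [n [u [u0 cE]]] := polytopeP c; move=> xc.
have [x1|x1] := pselect (sphere x); last by exists 1.
have [i /negP] : exists i, ~ (0 <= dot (u i) x).
  by apply: contrapT => /forallNP H; apply: xc; rewrite cE; split=> // i;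
    apply: contrapT; exact: H.
rewrite -ltNge => ux; have ui0 : 0 < enorm (u i) by rewrite enorm_gt0.
exists (- dot (u i) x / enorm (u i)); first by rewrite divr_gt0// oppr_gt0.
move=> y; rewrite cE => -[y1 /(_ i) uy] _.
rewrite ler_pdivrMr// mulrC (le_trans _ (dot_edist _ _ _))//.
by rewrite distrC (le_trans _ (ler_norm _))// lerDr.
Qed.

Lemma hypersphere_sphere S : sval S `<=` sphere.
Proof. by have [u _ ->] := hypersphere_normal S; move=> x []. Qed.

Lemma measurable_polytope_open (G : set polytope) : hausdorff_open G -> measurable G.
Proof. exact: sub_sigma_algebra. Qed.

Lemma measurable_hypersphere_open (G : set hypersphere) : hausdorff_open G ->
  measurable G.
Proof. exact: sub_sigma_algebra. Qed.

Lemma polytope_hausdorff_lt c c' (e : R) : hausdorff_dist (sval c) (sval c') < e ->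
  (forall x, sval c x -> exists2 y, sval c' y & edist x y < e) /\
  (forall y, sval c' y -> exists2 x, sval c x & edist x y < e).
Proof.
by apply: hausdorff_dist_lt; [exact: polytope_sphere|exact: polytope_sphere|
  exact: polytope_nonempty|exact: polytope_nonempty].
Qed.

Definition containing (Q : set V) : set polytope := [set c | Q `<=` sval c].

Lemma measurable_containing1 x : sphere x -> measurable (containing [set x]).
Proof.
move=> x1; rewrite -[X in measurable X]setCK; apply: measurableC.
apply: measurable_polytope_open => c /= nc.
have xc : ~ sval c x by move=> xc; apply: nc => _ ->.
have [e e0 He] := polytope_far xc; exists e => // c' cc' xc'.
have [_ /(_ x (xc' _ erefl))[y cy]] := polytope_hausdorff_lt cc'.
by rewrite edistC ltNge He.
Qed.

Lemma measurable_containing (Q : set V) : finite_set Q -> Q `<=` sphere ->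
  measurable (containing Q).
Proof.
move=> fQ Q1; have -> : containing Q = \bigcap_(x in Q) containing [set x].
  apply/seteqP; split=> c; first by move=> Qc x Qx _ ->; exact: Qc.
  by move=> H x Qx; exact: (H x Qx).
apply: fin_bigcap_measurable => // x /Q1; exact: measurable_containing1.
Qed.

Lemma measurable_polytope1 c : measurable [set c].
Proof.
rewrite -[X in measurable X]setCK; apply: measurableC.
apply: measurable_polytope_open => c' /= c'c.
have : (exists2 x, sval c x & ~ sval c' x) \/ ~ (sval c' `<=` sval c).
  have [H|] := pselect (sval c' `<=` sval c); last by right.
  left; apply: contrapT => /forall2NP N; apply: c'c; apply: polytope_inj.
  by apply/seteqP; split=> // x cx; have [//|/contrapT] := N x.
case=> [[x cx xc']|/existsNP[x /not_implyP[c'x xc]]].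
- have [e e0 He] := polytope_far xc'; exists e => // b cb bc; subst b.
  have [_ /(_ _ cx)[y cy]] := polytope_hausdorff_lt cb.
  by rewrite edistC ltNge He//; exact: polytope_sphere cx.
- have [e e0 He] := polytope_far xc; exists e => // b cb bc; subst b.
  have [/(_ _ c'x)[y cy xy] _] := polytope_hausdorff_lt cb.
  by move: xy; rewrite ltNge He//; exact: polytope_sphere c'x.
Qed.

Lemma exists_orthogonal v : (0 < d)%N -> exists2 z, sphere z & dot v z = 0.
Proof.
move=> d0.
suff [z z0 vz] : exists2 z, z != 0 & dot v z = 0.
  exists (normalize z); first exact: normalize_sphere.
  by rewrite dotZr vz mulr0.
pose i1 : 'I_d.+1 := Ordinal (d0 : (1 < d.+1)%N).
have i10 : (i1 == ord0) = false by [].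
pose del (i : 'I_d.+1) : V := delta_mx 0 i.
have dotdel i : dot v (del i) = v 0 i.
  rewrite /dot (bigD1 i)//= big1 ?addr0 => [|j ji].
    by rewrite mxE !eqxx mulr1.
  by rewrite mxE eqxx/= (negbTE ji) mulr0.
pose z := v 0 i1 *: del ord0 - v 0 ord0 *: del i1.
have vz : dot v z = 0 by rewrite dotDr dotNr !dotZr !dotdel mulrC subrr.
have [z0|z0] := eqVneq z 0; last by exists z.
exists (del ord0).
  by apply/eqP => /rowP/(_ ord0); rewrite !mxE !eqxx => /eqP; rewrite oner_eq0.
rewrite dotdel; have /rowP/(_ i1) := z0.
by rewrite !mxE !eqxx i10 /= mulr0 add0r mulr1 => /eqP; rewrite oppr_eq0 => /eqP.
Qed.

Definition unit_normal S : V :=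
  normalize (s2val (cid2 (hypersphere_normal S))).

Lemma unit_normal_sphere S : sphere (unit_normal S).
Proof. apply: normalize_sphere; exact: s2valP (cid2 (hypersphere_normal S)). Qed.

Lemma unit_normalE S : sval S = [set x | sphere x /\ dot (unit_normal S) x = 0].
Proof.
rewrite /unit_normal; case: cid2 => u u0 /= ->; apply/seteqP; split=> x /= [x1 ux].
  by split=> //; rewrite dotZl ux mulr0.
split=> //; apply/eqP; have /eqP := ux.
by rewrite dotZl mulf_eq0 invr_eq0 -/(enorm u) gt_eqF// enorm_gt0.
Qed.

Lemma half_sphere_unit_normal S h : half_sphere_of (sval S) h <->
  h = [set x | sphere x /\ 0 <= dot (unit_normal S) x] \/
  h = [set x | sphere x /\ 0 <= dot (- unit_normal S) x].
Proof.
have u0 := sphere_neq0 (unit_normal_sphere S).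
split.
  move=> [v [v0 Sv ->]].
  have [a a0 ->] : exists2 a, a != 0 & v = a *: unit_normal S.
    by apply: normal_uniq => //; rewrite -unit_normalE.
  have [aN|aP|/eqP] := ltgtP a 0; last by rewrite (negbTE a0).
    right; apply/seteqP; split=> x /= [x1]; rewrite dotZl dotNl oppr_ge0.
      by rewrite nmulr_rge0.
    by rewrite nmulr_rge0.
  by left; apply/seteqP; split=> x /= [x1]; rewrite dotZl pmulr_rge0.
case=> ->; [exists (unit_normal S)|exists (- unit_normal S)]; split=> //.
- exact: unit_normalE.
- by rewrite oppr_eq0.
- rewrite unit_normalE; apply/seteqP; split=> x /= [x1]; rewrite dotNl => ux.
    by rewrite ux oppr0.
  by split=> //; apply/eqP; rewrite -oppr_eq0 ux.
Qed.

(* It does not depend on the orientation of the normal, and is negative iff S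
   separates x from y. *)
Definition height_product x y S : R :=
  dot (unit_normal S) x * dot (unit_normal S) y.

(** The component w of the normal u orthogonal to u' points to a point of S'. Some point of S, where
    [dot u] vanishes, is within e of it, so enorm w <= e. The factor a absorbs the arbitrary
    orientation of the normals. *)
Lemma hypersphere_normal_near S S' (e : R) :
  hausdorff_dist (sval S) (sval S') < e -> sval S !=set0 -> sval S' !=set0 ->
  exists a : R, forall x, sphere x ->
    `|dot (unit_normal S) x - a * dot (unit_normal S') x| <= e.
Proof.
move=> SS' S0 S'0.
have [_ near] := hausdorff_dist_lt (@hypersphere_sphere S) (@hypersphere_sphere S') S0 S'0 SS'.
set u := unit_normal S in near *; set u' := unit_normal S' in near *.
have u1 : sphere u by exact: unit_normal_sphere.
have u'1 : dot u' u' = 1 by exact: unit_normal_sphere.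
have e0 : 0 <= e by have [y /near[x _ /ltW]] := S'0; apply: le_trans; exact: edist_ge0.
exists (dot u u'); pose w := u - dot u u' *: u'; move=> x x1.
have -> : dot u x - dot u u' * dot u' x = dot w x.
  by rewrite /w dotDl dotNl dotZl.
suff we : enorm w <= e by rewrite (le_trans (dot_sphere_le1 w x1)).
have [->|w0] := eqVneq w 0.
  by rewrite -(scale0r 0) enormZ normr0 mul0r.
have u'w : dot u' w = 0 by rewrite /w dotDr dotNr dotZr u'1 mulr1 dotC subrr.
have S'w : sval S' (normalize w).
  rewrite unit_normalE; split; first exact: normalize_sphere.
  by rewrite dotZr u'w mulr0.
have [s Ss sw] := near _ S'w.
have us : dot u s = 0 by move: Ss; rewrite unit_normalE => -[].
have ww : dot u (normalize w) = enorm w.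
  rewrite -(enorm_normalize w0) {2}/w dotDl dotNl dotZl [dot u' _]dotZr u'w.
  by rewrite !mulr0 subr0.
have := dot_edist u s (normalize w).
rewrite us ww sub0r normrN (ger0_norm (enorm_ge0 _)) (sphere_enorm u1) mul1r.
by move=> /le_trans; apply; exact: ltW.
Qed.

(** The unknown a, of either sign, enters the product as a^2 > 0. *)
Lemma sign_perturb (p q p' q' a e : R) : `|p - a * p'| <= e -> `|q - a * q'| <= e ->
  e < `|p| -> e < `|q| -> Num.sg (p' * q') = Num.sg (p * q).
Proof.
move=> pp' qq' ep eq.
have sgE (r r' : R) : `|r - a * r'| <= e -> e < `|r| -> Num.sg (a * r') = Num.sg r.
  rewrite ler_norml => /andP[r1 r2]; have [r0|r0] := leP 0 r.
    rewrite (ger0_norm r0) => er; rewrite !gtr0_sg//; last lra.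
    by have := ler_norm (r - a * r'); lra.
  rewrite (ltr0_norm r0) => er; rewrite !ltr0_sg//; lra.
have a0 : a != 0.
  apply/eqP => a0; move: (sgE p p' pp' ep); rewrite a0 mul0r sgr0 => /esym/eqP.
  by rewrite sgr_eq0 => /eqP p0; move: ep pp'; rewrite p0 a0 !mul0r subr0 normr0; lra.
rewrite !sgrM -(sgE p p' pp' ep) -(sgE q q' qq' eq) !sgrM mulrACA -expr2.
by rewrite sqr_sg a0 mul1r.
Qed.

Hypothesis d0 : (0 < d)%N.

Lemma hypersphere_has_point S : sval S !=set0.
Proof.
have [z z1 uz] := exists_orthogonal (unit_normal S) d0.
by exists z; rewrite unit_normalE.
Qed.

Lemma height_product_sg_open x y (s : R) : sphere x -> sphere y -> s != 0 ->
  hausdorff_open [set S | Num.sg (height_product x y S) = s].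
Proof.
move=> x1 y1 s0 S /= Ss.
have : height_product x y S != 0 by rewrite -sgr_eq0 Ss.
rewrite mulf_eq0 negb_or -!normr_gt0 => /andP[px py].
pose m := Num.min `|dot (unit_normal S) x| `|dot (unit_normal S) y|.
have m0 : 0 < m by rewrite lt_min px.
exists (m / 2); first by rewrite divr_gt0.
move=> S' SS'; rewrite /= -Ss.
have [a Ha] := hypersphere_normal_near SS' (hypersphere_has_point S) (hypersphere_has_point S').
apply: (@sign_perturb _ _ _ _ a (m / 2)); [exact: Ha|exact: Ha| |].
  by apply: (@lt_le_trans _ _ m); rewrite ?ge_min ?lexx// ltr_pdivrMr//; lra.
by apply: (@lt_le_trans _ _ m); rewrite ?ge_min ?lexx ?orbT// ltr_pdivrMr//; lra.
Qed.

Definition separating (Q : set V) : set hypersphere :=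
  [set S | exists x y, [/\ Q x, Q y & height_product x y S < 0]].

Lemma measurable_separating (Q : set V) : finite_set Q -> Q `<=` sphere ->
  measurable (separating Q).
Proof.
move=> fQ Q1.
have -> : separating Q = \bigcup_(x in Q) \bigcup_(y in Q)
    [set S | Num.sg (height_product x y S) = -1].
  apply/seteqP; split=> S /=.
    by move=> [x [y [Qx Qy xy]]]; exists x => //; exists y => //=; rewrite ltr0_sg.
  move=> [x Qx [y Qy] /= /eqP]; rewrite sgr_cp0 => xy.
  by exists x, y.
apply: fin_bigcup_measurable => // x Qx; apply: fin_bigcup_measurable => // y Qy.
apply: measurable_hypersphere_open; apply: height_product_sg_open.
- exact: Q1.
- exact: Q1.
- by rewrite oppr_eq0 oner_eq0.
Qed.

Lemma measurable_through x : sphere x -> measurable [set S : hypersphere | sval S x].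
Proof.
move=> x1; have -> : [set S : hypersphere | sval S x] =
    ~` [set S | Num.sg (height_product x x S) = 1].
  apply/seteqP; split=> S /=; rewrite /height_product unit_normalE.
    by move=> [_ ->]; rewrite mulr0 sgr0 => /eqP; rewrite eq_sym oner_eq0.
  move=> H; split=> //; apply: contrapT => /eqP ux; apply: H.
  by rewrite gtr0_sg// -expr2 exprn_even_gt0.
apply: measurableC; apply: measurable_hypersphere_open;
  apply: height_product_sg_open => //.
Qed.

End polytope_geometry.
Lemma bigcup_countType_measurable dT (T : measurableType dT) (I : countType)
    (P : set I) (F : I -> set T) :
  (forall i, P i -> measurable (F i)) -> measurable (\bigcup_(i in P) F i).
Proof.
move=> mF; pose G n := if unpickle n is Some i then
  (if pselect (P i) then F i else set0) else set0.
have -> : \bigcup_(i in P) F i = \bigcup_n G n.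
  apply/seteqP; split=> [x [i Pi Fi]|x [n _]].
    by exists (pickle i) => //; rewrite /G pickleK; case: pselect.
  by rewrite /G; case: unpickle => // i; case: pselect => // Pi Fi; exists i.
apply: bigcupT_measurable => n; rewrite /G; case: unpickle => // i.
by case: pselect => //= Pi; exact: mF.
Qed.

Section dotr_linear.
Context {R : realType} {d : nat}.
Local Notation V := 'rV[R]_d.+1.

(** The codomain is [R^o], a vector space, so that [dot u] becomes a linear map with a kernel
    [lker]. *)
Definition dotr (u : V) : V -> R^o := dot u.

Lemma dotr_is_linear u : linear (dotr u).
Proof. by move=> a x y; rewrite /dotr dotDr dotZr. Qed.

HB.instance Definition _ u := GRing.isLinear.Build R V R^o _ (dotr u) (dotr_is_linear u).

End dotr_linear.

(** * Full-dimensional polytopes and the rational grid *)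

Section full_polytopes.
Context {R : realType} {d : nat}.
Local Notation V := 'rV[R]_d.+1.
Local Notation polytope := (polytope R d).
Implicit Types (u v x y z : V) (c : polytope).

Definition full c := has_sdim (sval c) d.

Lemma near_forall_dot_gt0 n (u : 'I_n -> V) x : (forall i, 0 < dot (u i) x) ->
  \forall y \near x, forall i, 0 < dot (u i) y.
Proof.
move=> ux; apply: (@filter_forall V 'I_n (fun i =>
  [set y | 0 < dot (u i) y]) (nbhs x) _) => i.
apply/nbhs_edistP; have ui : 0 < enorm (u i).
  rewrite enorm_gt0; apply: contraTneq (ux i) => ->.
  by rewrite dot0x ltxx.
exists (dot (u i) x / enorm (u i)); first by rewrite divr_gt0.
move=> y; rewrite ltr_pdivlMr// mulrC => xy /=.
have := le_lt_trans (dot_edist (u i) x y) xy.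
by rewrite ltr_norml => /andP[_]; lra.
Qed.

Section representation.
Variables (c : polytope) (n : nat) (u : 'I_n -> V).
Hypotheses (u0 : forall i, u i != 0)
  (cE : sval c = [set x | sphere x /\ forall i, 0 <= dot (u i) x]).

Lemma strict_sinterior x : sphere x -> (forall i, 0 < dot (u i) x) ->
  sinterior (sval c) x.
Proof.
move=> x1 ux; split=> //.
by apply: filterS (near_forall_dot_gt0 ux) => y uy y1; rewrite cE; split=> // i;
  rewrite ltW.
Qed.

(** A small move from x in the direction - u i stays in the polytope and strictly lowers
    [dot (u i)], which remains nonnegative. *)
Lemma sinterior_strict x : sinterior (sval c) x -> forall i, 0 < dot (u i) x.
Proof.
move=> ix i; have [e e0 [x0]] := sint_normalize (- u i) ix.
rewrite cE => -[_ /(_ i)]; rewrite dotZr pmulr_rge0; last first.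
  by rewrite invr_gt0 -/(enorm _) enorm_gt0.
rewrite dotDr dotZr dotNr mulrN subr_ge0; apply: lt_le_trans.
by rewrite mulr_gt0// dot_gt0.
Qed.

(** For each i some point of c satisfies the i-th inequality strictly, since otherwise c would lie
    in the hyperplane orthogonal to u i. The sum of these points satisfies all of them strictly. *)
Lemma full_strict_point : full c -> exists2 z, z != 0 & forall i, 0 < dot (u i) z.
Proof.
move=> [U [cU minU] dU].
have UT v : v \in U.
  have -> : U = fullv by apply/eqP;
    rewrite -(dimv_leqif_eq (subvf U)).2 dU dimvf /= /dim /= mul1n.
  exact: memvf.
have pos i : exists2 x, sval c x & 0 < dot (u i) x.
  apply: contrapT => /forall2NP N.
  have : (U <= lker (linfun (dotr (u i))))%VS.
    apply: minU => x cx /=; rewrite memv_ker lfunE /=.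
    have [//|/negP] := N x; rewrite -leNgt /dotr => ux.
    by rewrite eq_le ux; move: cx; rewrite cE => -[_ /(_ i) ->].
  move=> /subvP/(_ _ (UT (u i))); rewrite memv_ker lfunE /= /dotr.
  by rewrite dot_eq0 (negbTE (u0 i)).
have [n0|n0] := posnP n.
  have [x x1] := sphere_nonempty R d; exists x; first exact: sphere_neq0.
  by move=> [i ni]; exfalso; move: ni; rewrite n0.
pose x i := s2val (cid2 (pos i)).
have cx i : sval c (x i) by exact: s2valP.
have ux i : 0 < dot (u i) (x i) by exact: (s2valP' (cid2 (pos i))).
have uz i : 0 < dot (u i) (\sum_j x j).
  have -> : dot (u i) (\sum_j x j) = \sum_j dot (u i) (x j).
    elim/big_ind2 : _ => [|*|//]; first by rewrite dotx0.
    by rewrite dotDr; congr (_ + _).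
  rewrite (bigD1 i)//= ltr_wpDr//; apply: sumr_ge0 => j _.
  by have := cx j; rewrite cE => -[_ /(_ i)].
exists (\sum_j x j) => //; have := uz (Ordinal n0); apply: contraTneq => ->.
by rewrite dotx0 ltxx.
Qed.

End representation.

(** Adding to x a small multiple of a strict point makes every inequality strict. The neighbourhood
    is taken in the ambient space, so that a rational vector can be chosen before normalizing. *)
Lemma full_near c x (e : R) : full c -> sval c x -> 0 < e ->
  exists v, edist x v < e /\ \forall y \near v, y != 0 ->
    sinterior (sval c) (normalize y).
Proof.
move=> fc cx e0; have [n [u [u0 cE]]] := polytopeP c.
have [z z0 uz] := full_strict_point u0 cE fc.
have zN : 0 < enorm z by rewrite enorm_gt0.
pose s := e / (2 * enorm z); have s0 : 0 < s by rewrite divr_gt0// mulr_gt0.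
exists (x + s *: z); split.
  rewrite edistE opprD addrA subrr add0r enormN enormZ (gtr0_norm s0) /s.
  have -> : e / (2 * enorm z) * enorm z = e / 2 by field; rewrite gt_eqF.
  lra.
have pos i : 0 < dot (u i) (x + s *: z).
  rewrite dotDr dotZr ltr_wpDl//; first by move: cx; rewrite cE => -[_ ->].
  by rewrite mulr_gt0.
apply: filterS (near_forall_dot_gt0 pos) => y uy y0; apply: (strict_sinterior cE).
  exact: normalize_sphere.
by move=> i; rewrite dotZr mulr_gt0// invr_gt0 -/(enorm _) enorm_gt0.
Qed.

Definition grid_index := 'rV[rat]_d.+1.

(* The normalization of q; at q = 0, a junk point of the sphere. *)
Definition grid (q : grid_index) : V :=
  let v := map_mx ratr q in
  if v == 0 then projT1 (cid (sphere_nonempty R d)) else normalize v.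

Lemma grid_sphere q : sphere (grid q).
Proof.
rewrite /grid; case: eqVneq => [_|]; last exact: normalize_sphere.
exact: projT2 (cid (sphere_nonempty R d)).
Qed.

Lemma full_grid_dense c x (e : R) : full c -> sval c x -> 0 < e ->
  exists2 q, sinterior (sval c) (grid q) & edist x (grid q) < e.
Proof.
move=> fc cx e0; have x1 := polytope_sphere cx.
(* The rational vector will be closer than 2 r <= 1 to x, as [edist_normalize] requires; normalizing
   doubles this to less than 4 r <= e. *)
pose r := Num.min (e / 4) (1 / 2).
have r0 : 0 < r by rewrite lt_min !divr_gt0.
have [v [xv /nbhs_edistP[e1 e10 He1]]] := full_near fc cx r0.
pose r1 := Num.min e1 r; have r10 : 0 < r1 by rewrite lt_min e10.
have /(_ _)/cid2 Q i : exists2 q : rat, True & `|v 0 i - ratr q| <= r1 / d.+2%:R.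
  have d0 : 0 < r1 / d.+2%:R by rewrite divr_gt0.
  have /rat_in_itvoo[q] : v 0 i - r1 / d.+2%:R < v 0 i + r1 / d.+2%:R.
    by rewrite ltrBlDr -addrA ltrDl addr_gt0.
  rewrite in_itv/= => /andP[q1 q2]; exists q => //; move: q1 q2.
  by set a := r1 / _ => q1 q2; rewrite ler_norml; apply/andP; split; lra.
pose q : grid_index := \row_i s2val (Q i).
have vq : edist v (map_mx ratr q) < r1.
  apply: (@le_lt_trans _ _ (d.+1%:R * (r1 / d.+2%:R))).
    by apply: edist_coord => i; rewrite !mxE; exact: (s2valP' (Q i)).
  by rewrite mulrA ltr_pdivrMr// mulrC ltr_pM2l// ltr_nat.
move: vq; rewrite lt_min => /andP[vqe vqr].
have xq : edist x (map_mx ratr q) < 2 * r.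
  by rewrite (le_lt_trans (edist_triangle v _ _))//; lra.
have r_e : r <= e / 4 by rewrite ge_min lexx.
have r_1 : r <= 1 / 2 by rewrite ge_min lexx orbT.
have [|q0 xq2] := @edist_normalize _ _ x (map_mx ratr q) x1; first by lra.
have gE : grid q = normalize (map_mx ratr q) by rewrite /grid (negbTE q0).
by exists q; rewrite gE; [exact: He1|lra].
Qed.

Lemma polytope_compact c : compact (sval c).
Proof.
apply: bounded_closed_compact.
  exists 1; split; first exact: num_real.
  move=> M M1 x /polytope_sphere x1; apply: le_trans (ltW M1).
  rewrite [leLHS]/Num.norm/= mx_normrE; apply: bigmax_le => // -[i j] _ /=.
  have := coord_edist x 0 j; rewrite mxE subr0 edistE subr0 sphere_enorm//.
  by rewrite (ord1 i).
move=> x clx; apply: contrapT => xc.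
have x1 : sphere x.
  suff : enorm x = 1 by rewrite /sphere /= -sqr_enorm => ->; rewrite expr1n.
  apply/eqP; rewrite eq_le; apply/andP; split; apply/ler_addgt0Pr => /= e e0.
    have [|y [/polytope_sphere/sphere_enorm cy xy]] := clx [set y | edist x y < e].
      by apply/nbhs_edistP; exists e.
    have := enormD (x - y) y; rewrite subrK cy -edistE; rewrite /= in xy; lra.
  have [|y [/polytope_sphere/sphere_enorm cy xy]] := clx [set y | edist x y < e].
    by apply/nbhs_edistP; exists e.
  have := enormD (y - x) x; rewrite subrK cy -edistE edistC; rewrite /= in xy; lra.
have [e e0 He] := polytope_far xc.
have [|y [cy xy]] := clx [set y | edist x y < e]; first by apply/nbhs_edistP; exists e.
by have := He y cy x1; rewrite leNgt; rewrite /= in xy; rewrite xy.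
Qed.

Lemma full_net c (r : R) : full c -> 0 < r -> exists F : seq grid_index,
  (forall q, q \in F -> sval c (grid q)) /\
  forall x, sval c x -> exists2 q, q \in F & edist (grid q) x < r.
Proof.
move=> fc r0.
have : cover_compact (sval c) by rewrite -compact_cover; exact: polytope_compact.
move=> /(_ grid_index [set q | sval c (grid q)] (fun q =>
  [set x | edist (grid q) x < r])).
case.
- move=> q _; rewrite openE => x /= xr; apply/nbhs_edistP.
  exists (r - edist (grid q) x); first by rewrite subr_gt0.
  by move=> y; rewrite ltrBrDl; apply: le_lt_trans; exact: edist_triangle.
- move=> x cx; have [q /sinterior_sub cq xq] := full_grid_dense fc cx r0.
  by exists q => //=; rewrite edistC.
- move=> D Dc cD; exists (enum_fset D); split.
    by move=> q qD; have := Dc q qD; rewrite inE.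
  by move=> x /cD[q qD xq]; exists q.
Qed.

(** Indexed by finite sequences rather than single points: intersecting two events concatenates
    their sequences, so this is a pi-system. *)
Definition grid_sets : set (set polytope) :=
  [set E | exists F : seq grid_index, E = containing [set grid q | q in [set` F]]].

Lemma containing_grid q : <<s grid_sets >> (containing [set grid q]).
Proof.
apply: sub_sigma_algebra; exists [:: q]; congr containing.
apply/seteqP; split=> x /=; first by move=> ->; exists q => //=; rewrite inE.
by move=> [q' /=]; rewrite inE => /eqP -> ->.
Qed.

(* These sets replace the Hausdorff balls: they are visibly generated by the
   events of containing a grid point, and are small in Hausdorff distance by
   the density of the grid in full-dimensional polytopes. *)
Definition net_set (F : seq grid_index) (r : R) : set polytope :=
  containing [set grid q | q in [set` F]] `&`
  \bigcap_(q in [set q | forall p, p \in F -> r < edist (grid p) (grid q)])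
    ~` containing [set grid q].

Lemma measurable_net_set F r : <<s grid_sets >> (net_set F r).
Proof.
pose T : measurableType _ := g_sigma_algebraType grid_sets.
apply: (@measurableI _ T).
  by apply: sub_sigma_algebra; exists F.
set E := (X in measurable X); rewrite -[E]setCK; apply: (@measurableC _ T).
rewrite /E setC_bigcap; apply: (@bigcup_countType_measurable _ T) => q _.
rewrite setCK; exact: containing_grid.
Qed.

(** The points of F belong to both polytopes, and every grid point of either is within r of F.
    Density of the grid extends this to all points. *)
Lemma net_set_hausdorff F r c c' : full c -> full c' -> net_set F r c ->
  net_set F r c' -> hausdorff_dist (sval c) (sval c') <= r.
Proof.
have half c1 c2 : full c1 -> net_set F r c1 -> net_set F r c2 ->
    forall x, sval c1 x -> forall e : R, 0 < e ->
      exists2 y, sval c2 y & edist x y <= r + e.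
  move=> f1 [_ W1] [F2 _] x cx e e0.
  have [q /sinterior_sub cq xq] := full_grid_dense f1 cx e0.
  have [p pF pq] : exists2 p, p \in F & edist (grid p) (grid q) <= r.
    apply: contrapT => /forall2NP N; apply: (W1 q) => [p pF|_ ->//].
    by have [//|/negP] := N p; rewrite -ltNge.
  exists (grid p); first by apply: F2; exists p.
  apply: le_trans (edist_triangle (grid q) _ _) _.
  by rewrite addrC lerD ?(ltW xq)// edistC.
move=> f1 f2 W1 W2; apply: hausdorff_dist_le; [exact: polytope_nonempty..| |].
  exact: half.
by move=> y c'y e e0; have [x cx] := half _ _ f2 W2 W1 y c'y e e0; exists x;
  rewrite // edistC.
Qed.

(** It suffices to treat open sets. On full-dimensional polytopes an open G is the union of the net
    sets of radius 1 / (k + 1) whose full members lie in G, and there are only countably many net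
    sets. Lower-dimensional polytopes may miss the grid altogether. *)
Lemma borel_grid (E : set polytope) : measurable E ->
  exists2 E', <<s grid_sets >> E' & forall c, full c -> (E c <-> E' c).
Proof.
pose T : measurableType _ := g_sigma_algebraType grid_sets.
pose C : set (set polytope) := [set E | exists2 E', <<s grid_sets >> E' &
  forall c, full c -> (E c <-> E' c)].
suff : <<s @hausdorff_open R d (@nonempty_polytope R d) >> `<=` C by apply.
apply: smallest_sub.
  split.
  - by exists set0 => //; exact: (@measurable0 _ T).
  - move=> A [A' mA' AA']; exists (~` A'); first exact: (@measurableC _ T).
    by move=> c fc /=; split=> [[_ nA] /AA'-/(_ fc)/nA//|nA'];
      split=> // /AA'-/(_ fc)/nA'.
  - move=> F /(_ _)/cid2 H; pose F' i := s2val (H i).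
    exists (\bigcup_i F' i).
      by apply: (@bigcupT_measurable _ T) => i; exact: s2valP.
    move=> c fc; split=> -[i _ Fi]; exists i => //.
      exact/(s2valP' (H i) c fc).
    exact/(s2valP' (H i) c fc).
move=> G oG.
pose P := [set Fk : seq grid_index * nat |
  forall c, full c -> net_set Fk.1 Fk.2.+1%:R^-1 c -> G c].
exists (\bigcup_(Fk in P) net_set Fk.1 Fk.2.+1%:R^-1).
  by apply: (@bigcup_countType_measurable _ T) => Fk _; exact: measurable_net_set.
move=> c fc; split=> [Gc|[Fk /= PFk]]; last exact: PFk.
have [e e0 He] := oG c Gc.
pose k := Num.truncn e^-1.
have ke : k.+1%:R^-1 < e.
  rewrite invf_plt ?posrE//; exact: truncnS_gt.
have [F [Fc Fnet]] := @full_net c k.+1%:R^-1 fc ltac:(by rewrite invr_gt0).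
have cW : net_set F k.+1%:R^-1 c.
  split; first by move=> _ [q qF <-]; exact: Fc.
  move=> q /= Hq /(_ _ erefl) /Fnet[p pF]; rewrite ltNge => /negP; apply.
  by rewrite ltW// Hq.
exists (F, k) => // c' fc' /= W'; apply: He.
by apply: le_lt_trans ke; exact: (net_set_hausdorff fc fc' cW W').
Qed.

End full_polytopes.
(** * The splitting process *)

Section tessellations.
Context {R : realType} {d : nat}.
Local Notation V := 'rV[R]_d.+1.
Local Notation polytope := (polytope R d).
Local Notation hypersphere := (hypersphere R d).
Local Notation tessellation := (tessellation R d).
Implicit Types (x y q : V) (c : polytope) (S : hypersphere) (T : tessellation)
  (B : set polytope) (Q : set V).

Lemma finite_tessellation T : finite_set (sval T).
Proof. by case: (svalP T). Qed.

Lemma tessellation_full T c : sval T c -> full c.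
Proof. by case: (svalP T) => _ + _ _; apply. Qed.

Lemma tessellation_inj T T' : sval T = sval T' -> T = T'.
Proof. by case: T T' => [A PA] [B PB] /= AB; exact: eq_exist. Qed.

Lemma tessellation_cover T x : sphere x -> exists2 c, sval T c & sval c x.
Proof. by move=> x1; have [_ _ _ TE] := svalP T; move: x1; rewrite -TE. Qed.

Lemma measurable_card_cells B n : measurable B ->
  measurable [set T : tessellation | sval T `&` B #= `I_n].
Proof. by move=> mB; apply: sub_sigma_algebra; exists B, n. Qed.

Definition has_cell B : set tessellation := [set T | sval T `&` B !=set0].

Lemma measurable_has_cell B : measurable B -> measurable (has_cell B).
Proof.
move=> mB; have -> : has_cell B = ~` [set T | sval T `&` B #= `I_0].
  apply/seteqP; split=> T; rewrite /has_cell/= II0 => H.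
    by rewrite card_eq0 => /eqP H0; move: H; rewrite H0 => -[].
  by apply/set0P; move: H; rewrite card_eq0 => /negP.
by apply: measurableC; exact: measurable_card_cells.
Qed.

(** T is characterized by having each of its finitely many cells and no cell outside this finite
    set. *)
Lemma measurable_tessellation1 T : measurable [set T].
Proof.
have mT : measurable (sval T).
  have -> : sval T = \bigcup_(c in sval T) [set c].
    by apply/seteqP; split=> [c Tc|c [c' Tc' ->//]]; exists c.
  apply: fin_bigcup_measurable; first exact: finite_tessellation.
  by move=> c _; exact: measurable_polytope1.
have -> : [set T] = \bigcap_(c in sval T) has_cell [set c] `&` ~` has_cell (~` sval T).
  apply/seteqP; split=> T' /=.
    by move=> ->; split=> [c Tc|[c []//]]; exists c.
  move=> [H1 H2]; apply: tessellation_inj; apply/seteqP; split=> c Tc.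
    by apply: contrapT => nTc; apply: H2; exists c.
  by have [c' [Tc' /= <-]] := H1 c Tc.
apply: measurableI.
  apply: fin_bigcap_measurable; first exact: finite_tessellation.
  by move=> c _; apply: measurable_has_cell; exact: measurable_polytope1.
by apply: measurableC; apply: measurable_has_cell; exact: measurableC.
Qed.

Definition ncells T : nat := #|` fset_set (sval T)|.

Lemma measurable_ncells : measurable_fun setT (fun T => (ncells T)%:R : R).
Proof.
move=> _ Y mY; rewrite setTI.
have -> : (fun T => (ncells T)%:R : R) @^-1` Y =
    \bigcup_(n in [set n | Y n%:R]) [set T | sval T `&` setT #= `I_n].
  apply/seteqP; split=> T /=.
    move=> YT; exists (ncells T) => //=; rewrite setIT.
    have /finite_setP[n Tn] := finite_tessellation T.
    by rewrite /ncells (card_fset_set Tn).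
  by move=> [n /= Yn]; rewrite setIT /ncells => /card_fset_set ->.
by apply: bigcup_measurable => n _; exact: measurable_card_cells.
Qed.

Definition upper_half S : set V := [set x | sphere x /\ 0 <= dot (unit_normal S) x].
Definition lower_half S : set V := [set x | sphere x /\ 0 <= dot (- unit_normal S) x].

Lemma oslash_cellsE T c S : sval T c -> hits c S ->
  exists c1 c2, [/\ sval c1 = sval c `&` upper_half S,
    sval c2 = sval c `&` lower_half S &
    sval (oslash c S T) = c1 |` (c2 |` (sval T `\ c))].
Proof.
move=> Tc cS; have [e [Se /sinterior_sub ce]] := cS.
have [c1 c1E] : exists c1, sval c1 = sval c `&` upper_half S.
  by apply: (polytope_half _ Se ce); apply/half_sphere_unit_normal; left.
have [c2 c2E] : exists c2, sval c2 = sval c `&` lower_half S.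
  by apply: (polytope_half _ Se ce); apply/half_sphere_unit_normal; right.
exists c1, c2; split=> //; rewrite oslashE//; apply/seteqP; split=> c'.
  move=> [Tc'|[h /half_sphere_unit_normal[] -> c'E]]; first by right; right.
    by left; apply: polytope_inj; rewrite c1E.
  by right; left; apply: polytope_inj; rewrite c2E.
move=> [->|[->|Tc']]; [right|right|by left].
  by exists (upper_half S) => //; apply/half_sphere_unit_normal; left.
by exists (lower_half S) => //; apply/half_sphere_unit_normal; right.
Qed.

Lemma ncells_oslash T c S : sval T c -> hits c S ->
  (ncells (oslash c S T) <= (ncells T).+1)%N.
Proof.
move=> Tc cS; have [c1 [c2 [_ _ E]]] := oslash_cellsE Tc cS.
have fT := finite_tessellation T.
have fT1 : finite_set (sval T `\ c) by exact: finite_setD.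
have fT2 : finite_set (c2 |` (sval T `\ c)) by rewrite finite_setU; split=> //;
  exact: finite_set1.
rewrite /ncells E (fset_setU1 _ fT2) (fset_setU1 _ fT1) fset_setD1//.
have -> : #|` fset_set (sval T)| = (#|` fset_set (sval T) `\ c|%fset).+1.
  by rewrite (cardfsD1 c) in_fset_set// mem_set.
rewrite !cardfsU1 -[X in (_ <= X)%N]/(1 + (1 + _))%N.
by apply: leq_add; [exact: leq_b1|apply: leq_add => //; exact: leq_b1].
Qed.

(** Stated as a cell count, so that measurability is immediate. It places q in the interior of its
    cell ([regular_at_sinterior]). *)
Definition regular_at q : set tessellation :=
  [set T | sval T `&` containing [set q] #= `I_1].

Lemma measurable_regular_at q : sphere q -> measurable (regular_at q).
Proof. by move=> q1; apply: measurable_card_cells; exact: measurable_containing1. Qed.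

Lemma regular_atP q T : regular_at q T <->
  exists c0, [/\ sval T c0, sval c0 q & forall c, sval T c -> sval c q -> c = c0].
Proof.
split=> [/card_fset_set|[c0 [Tc0 c0q uniq]]].
  have fTq : finite_set (sval T `&` containing [set q]).
    exact/finite_setIl/finite_tessellation.
  move=> /eqP/cardfs1P[c0 c0E].
  have memE c : (sval T `&` containing [set q]) c <-> c = c0.
    have : (c \in fset_set (sval T `&` containing [set q])) = (c == c0).
      by rewrite c0E in_fset1.
    rewrite in_fset_set// => H; split=> [Hc|cc0].
      by apply/eqP; rewrite -H; exact: mem_set.
    by apply/set_mem; rewrite H; exact/eqP.
  exists c0; have [_ /(_ erefl)[Tc0 c0q]] := memE c0; split=> //; first exact: c0q.
  by move=> c Tc cq; apply/memE; split=> // _ ->.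
rewrite /regular_at/= (_ : _ `&` _ = [set c0]); first exact: card_set1.
apply/seteqP; split=> c /=; first by move=> [Tc cq]; apply: uniq => //; exact: cq.
by move=> ->; split=> // _ ->.
Qed.

(** The other cells are finitely many and each is at positive distance from q, so c alone covers the
    sphere near q. *)
Lemma regular_at_sinterior q T c : sphere q -> regular_at q T -> sval T c ->
  sval c q -> sinterior (sval c) q.
Proof.
move=> q1 /regular_atP[c0 [Tc0 c0q uniq]] Tc cq; split=> //.
pose D := fset_set (sval T `\ c).
have fD : finite_set (sval T `\ c) by exact/finite_setD/finite_tessellation.
have : nbhs q (\bigcap_(c' in [set` D]) ~` sval c').
  apply: filter_bigI => c'; rewrite in_fset_set// inE => -[Tc' c'c].
  have [e e0 He] : exists2 e : R, 0 < e & forall y, sval c' y -> sphere q ->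
    e <= edist q y.
    by apply: polytope_far => c'q; apply: c'c; rewrite (uniq _ Tc' c'q) (uniq _ Tc cq).
  apply/nbhs_edistP; exists e => // y qy /He/(_ q1); rewrite leNgt.
  by rewrite qy.
apply: filterS => y Hy y1; have [c' Tc' c'y] := tessellation_cover T y1.
have [<-//|c'c] := pselect (c' = c).
by exfalso; apply: (Hy c') => //=; rewrite in_fset_set// inE.
Qed.

Lemma regular_at_oslash q T c S : sphere q -> ~ sval S q -> regular_at q T ->
  sval T c -> hits c S -> regular_at q (oslash c S T).
Proof.
move=> q1 Sq /regular_atP[c0 [Tc0 c0q uniq]] Tc cS; apply/regular_atP.
have [c1 [c2 [c1E c2E E]]] := oslash_cellsE Tc cS.
have uq : dot (unit_normal S) q != 0.
  by apply/eqP => uq; apply: Sq; rewrite unit_normalE.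
have [c0c|c0c] := pselect (c0 = c); last first.
  have cq : ~ sval c q by move=> cq; apply: c0c; rewrite (uniq c).
  exists c0; split=> //; first by rewrite E; right; right.
  move=> c'; rewrite E => -[->|[->|[Tc' _]]]; last exact: uniq.
    by rewrite c1E => -[].
  by rewrite c2E => -[].
subst c0.
have [uq0|uq0] := ltP 0 (dot (unit_normal S) q).
  exists c1; split; [by rewrite E; left|by rewrite c1E; split=> //; split=> //;
    rewrite ltW|].
  move=> c'; rewrite E => -[->//|[->|[Tc' c'c] c'q]].
    by rewrite c2E => -[_ [_]]; rewrite dotNl oppr_ge0 leNgt uq0.
  by exfalso; apply: c'c; exact: uniq.
exists c2; split; [by rewrite E; right; left|by rewrite c2E; split=> //; split=> //;
  rewrite dotNl oppr_ge0|].
move=> c'; rewrite E => -[->|[->//|[Tc' c'c] c'q]].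
  rewrite c1E => -[_ [_ uq1]]; exfalso; move: uq => /eqP; apply.
  by apply/eqP; rewrite eq_le uq0.
by exfalso; apply: c'c; exact: uniq.
Qed.

(** The segment between two separated points crosses the hyperplane of S and satisfies all
    inequalities of c strictly. *)
Lemma separating_hits c S Q : (0 < d)%N -> (forall q, Q q -> sinterior (sval c) q) ->
  separating Q S -> hits c S.
Proof.
move=> d0 Qc [x [y [/Qc ix /Qc iy]]]; rewrite /height_product => xy.
wlog xpos : x y ix iy xy / 0 < dot (unit_normal S) x.
  move=> W; have [xpos|xneg] := ltP 0 (dot (unit_normal S) x); first exact: (W x y).
  apply: (W y x) => //; first by rewrite mulrC.
  rewrite ltNge; apply/negP => yneg; move: xy.
  by rewrite ltNge => /negP; apply; exact: mulr_le0.
have yneg : dot (unit_normal S) y < 0 by move: xy; rewrite pmulr_rlt0.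
have [n [u [u0 cE]]] := polytopeP c.
have ux := sinterior_strict u0 cE ix; have uy := sinterior_strict u0 cE iy.
pose z := (- dot (unit_normal S) y) *: x + dot (unit_normal S) x *: y.
have Sz : dot (unit_normal S) z = 0.
  by rewrite /z dotDr !dotZr; ring.
have uz i : 0 < dot (u i) z.
  by rewrite /z dotDr !dotZr addr_gt0// mulr_gt0// oppr_gt0.
(* z vanishes only if x and y are antipodal. Strict inequalities at 0 are impossible, so c has no
   constraints and any point of S will do. *)
have [z0|z0] := eqVneq z 0.
  have [s Ss] := hypersphere_has_point d0 S; exists s; split=> //.
  apply: (strict_sinterior cE); first exact: hypersphere_sphere Ss.
  by move=> i; have := uz i; rewrite z0 dotx0 ltxx.
exists (normalize z); split.
  rewrite unit_normalE; split; first exact: normalize_sphere.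
  by rewrite dotZr Sz mulr0.
apply: (strict_sinterior cE); first exact: normalize_sphere.
by move=> i; rewrite dotZr mulr_gt0// invr_gt0 -/(enorm _) enorm_gt0.
Qed.

Lemma has_cell_oslash Q T c S : Q `<=` sphere -> Q !=set0 ->
  (forall q, Q q -> regular_at q T) -> sval T c -> Q `<=` sval c -> hits c S ->
  has_cell (containing Q) (oslash c S T) <-> ~ separating Q S.
Proof.
move=> Q1 [q0 Qq0] reg Tc Qc cS.
have [c1 [c2 [c1E c2E E]]] := oslash_cellsE Tc cS.
split=> [[c' []]|nsep].
  rewrite E => -[->|[->|[Tc' c'c] Qc']].
  - move=> Qc1 [x [y [/Qc1 + /Qc1 +]]]; rewrite c1E => -[_ [_ ux]] [_ [_ uy]].
    by rewrite ltNge mulr_ge0.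
  - move=> Qc2 [x [y [/Qc2 + /Qc2 +]]]; rewrite c2E => -[_ [_ ux]] [_ [_ uy]].
    by move: ux uy; rewrite !dotNl !oppr_ge0 ltNge => ux uy; rewrite mulr_le0.
  - have /regular_atP[c0 [_ _ uniq]] := reg _ Qq0.
    by exfalso; apply: c'c; rewrite (uniq c)//; [apply: uniq => //;
      exact: Qc'|exact: Qc].
have [[x Qx ux]|N] := pselect (exists2 x, Q x & 0 < dot (unit_normal S) x).
  exists c1; split; first by rewrite E; left.
  move=> y Qy; rewrite c1E; split; [exact: Qc|split; first exact: Q1].
  rewrite leNgt; apply/negP => uy; apply: nsep; exists x, y; split=> //.
  by rewrite /height_product pmulr_rlt0.
exists c2; split; first by rewrite E; right; left.
move=> y Qy; rewrite c2E; split; [exact: Qc|split; first exact: Q1].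
by rewrite dotNl oppr_ge0 leNgt; apply/negP => uy; apply: N; exists y.
Qed.

Lemma has_cell_oslash_other Q T c c0 S : sval T c -> hits c S -> sval T c0 ->
  c0 <> c -> Q `<=` sval c0 -> has_cell (containing Q) (oslash c S T).
Proof.
move=> Tc cS Tc0 c0c Qc0; have [c1 [c2 [_ _ E]]] := oslash_cellsE Tc cS.
by exists c0; split=> //; rewrite E; right; right.
Qed.

Lemma has_cell_oslash_sub Q T c S : sval T c -> hits c S ->
  has_cell (containing Q) (oslash c S T) -> has_cell (containing Q) T.
Proof.
move=> Tc cS [c' []]; have [c1 [c2 [c1E c2E E]]] := oslash_cellsE Tc cS.
rewrite E => -[->|[->|[Tc' _]]] Qc'; last by exists c'.
  by exists c; split=> // x /Qc'; rewrite c1E => -[].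
by exists c; split=> // x /Qc'; rewrite c2E => -[].
Qed.

End tessellations.
(** Valid without integrability or measurability: an infinite value is sent to 0 by [fine] on both
    sides. So the generator may be negated without discussing how the split tessellation depends on
    S. *)
Lemma RintegralN (dT : measure_display) (T : measurableType dT) (R : realType)
    (mu : {measure set T -> \bar R}) (D : set T) (f : T -> R) :
  \int[mu]_(x in D) - f x = - \int[mu]_(x in D) f x.
Proof.
rewrite /Rintegral integralE [in RHS]integralE.
have -> : (fun x => (- f x)%:E) = (\- (EFin \o f))%E by apply/funext => x;
  rewrite /= EFinN.
rewrite funeposN funenegN.
have : (0 <= \int[mu]_(x in D) ((EFin \o f)^\+ x))%E by exact: integral_ge0.
have : (0 <= \int[mu]_(x in D) ((EFin \o f)^\- x))%E by exact: integral_ge0.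
case: (\int[mu]_(x in D) ((EFin \o f)^\+ x))%E => [r| |];
  case: (\int[mu]_(x in D) ((EFin \o f)^\- x))%E => [s| |] //=; rewrite ?oppr0//.
by move=> _ _; rewrite opprB.
Qed.

Lemma indic_in (T : Type) (R : realType) (A : set T) x : A x -> \1_A x = 1 :> R.
Proof. by move=> Ax; rewrite indicE mem_set. Qed.

Lemma indic_notin (T : Type) (R : realType) (A : set T) x : ~ A x -> \1_A x = 0 :> R.
Proof. by move=> Ax; rewrite indicE memNset. Qed.

Lemma indic_le1 (T : Type) (R : realType) (A : set T) x : `|\1_A x : R| <= 1.
Proof. by rewrite ger0_norm// indicE lern1 leq_b1. Qed.

Lemma ae_finite_forall dT (T : measurableType dT) (R : realType)
    (mu : {measure set T -> \bar R}) (I : choiceType) (Q : set I) (P : I -> T -> Prop) :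
  finite_set Q -> (forall i, Q i -> {ae mu, forall x, P i x}) ->
  {ae mu, forall x, forall i, Q i -> P i x}.
Proof.
move=> fQ QP.
have : (almost_everywhere mu) (\bigcap_(i in [set` fset_set Q]) P i).
  by apply: filter_bigI => i; rewrite in_fset_set// inE; exact: QP.
by apply: filterS => x Px i Qi; apply: Px; rewrite /= in_fset_set// inE.
Qed.

(** * The splitting generator on particular functions *)

Section splitting_generator_values.
Context {R : realType} {d : nat}.
Local Notation V := 'rV[R]_d.+1.
Local Notation polytope := (polytope R d).
Local Notation hypersphere := (hypersphere R d).
Local Notation tessellation := (tessellation R d).
Implicit Types (x y q : V) (c : polytope) (S : hypersphere) (T : tessellation)
  (B : set polytope) (Q : set V) (f : tessellation -> R).
Variable kappa : probability hypersphere R.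
Hypothesis d0 : (0 < d)%N.

Let k1 : kappa setT = 1%E. Proof. exact: probability_setT. Qed.

Lemma splitting_generatorN f T :
  splitting_generator kappa (fun T => - f T) T = - splitting_generator kappa f T.
Proof.
rewrite /splitting_generator !(fsbig_finite _ _ (finite_tessellation T))/= -sumrN.
by apply: eq_bigr => c _; rewrite -RintegralN; apply: eq_Rintegral => S _;
  rewrite opprB opprK addrC.
Qed.

Lemma splitting_generator_le f T (b : R) (E : set hypersphere) : 0 <= b ->
  measurable E ->
  (forall c S, sval T c -> hits c S -> f (oslash c S T) - f T <= b * \1_E S) ->
  splitting_generator kappa f T <= (ncells T)%:R * (b * fine (kappa E)).
Proof.
move=> b0 mE fb;
  rewrite /splitting_generator (fsbig_finite _ _ (finite_tessellation T))/=.
have -> : (ncells T)%:R * (b * fine (kappa E)) =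
    \sum_(c <- fset_set (sval T)) b * fine (kappa E).
  by rewrite big_tnth sumr_const card_ord mulr_natl.
rewrite big_seq [leRHS]big_seq.
apply: ler_sum => c; rewrite in_fset_set ?inE; last exact: finite_tessellation.
by move=> Tc; apply: (Rintegral_le_indic k1) => // S cS; exact: fb.
Qed.

Lemma splitting_generator_le_cst f T (b : R) : 0 <= b ->
  (forall c S, sval T c -> hits c S -> f (oslash c S T) - f T <= b) ->
  splitting_generator kappa f T <= (ncells T)%:R * b.
Proof.
move=> b0 fb; have kT : fine (kappa setT) = 1 by have -> : kappa setT = 1%E := k1.
rewrite -[X in _ * X]mulr1 -[X in b * X]kT.
apply: (@splitting_generator_le f T b setT) => // c S Tc cS.
by rewrite indicT mulr1 fb.
Qed.

Lemma splitting_generator_singleton T :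
  - (ncells T)%:R <= splitting_generator kappa \1_[set T] T.
Proof.
rewrite lerNl -splitting_generatorN.
rewrite -[leRHS]mulr1; apply: splitting_generator_le_cst => [//|c S _ _].
by rewrite opprK (@indic_in _ _ _ T)// gerDr oppr_le0.
Qed.

Lemma splitting_generator_trunc n T :
  splitting_generator kappa (fun T =>
    (minn (ncells T) n)%:R) T <= (minn (ncells T) n)%:R.
Proof.
have [nT|Tn] := leqP n (ncells T).
  apply: (@le_trans _ _ ((ncells T)%:R * 0)); last by rewrite mulr0.
  apply: splitting_generator_le_cst => // c S Tc cS.
  by rewrite subr_le0 ler_nat (minn_idPr nT) geq_minr.
rewrite -[leRHS]mulr1.
apply: splitting_generator_le_cst => // c S Tc cS.
rewrite lerBlDr nat1r ler_nat (minn_idPl (ltnW Tn)).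
by rewrite (leq_trans (geq_minl _ _))// ncells_oslash.
Qed.

(** From a regular tessellation only a hypersphere through q can create irregularity, and these form
    a null set; at an irregular one the indicator is already maximal. *)
Lemma splitting_generator_irregular q T : regular kappa -> sphere q ->
  splitting_generator kappa \1_(~` regular_at q) T <= 0.
Proof.
move=> reg q1; have [Tq|Tq] := pselect (regular_at q T).
  apply: le_trans (splitting_generator_le ler01 (measurable_through d0 q1) _) _ =>
    [c S Tc cS|].
    rewrite mul1r (@indic_notin _ _ _ T) ?subr0; last by move=> /(_ Tq).
    have [Sq|Sq] := pselect (sval S q).
      by rewrite (@indic_in _ _ _ S)// (le_trans (ler_norm _))// indic_le1.
    by rewrite indic_notin//; apply; exact: regular_at_oslash.
  by rewrite reg// mulr0 mulr0.
apply: (@le_trans _ _ ((ncells T)%:R * 0)); last by rewrite mulr0.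
apply: splitting_generator_le_cst => // c S Tc cS.
by rewrite subr_le0 (@indic_in _ _ _ T)// (le_trans (ler_norm _))// indic_le1.
Qed.

Lemma splitting_generator_has_cell Q T : finite_set Q -> Q `<=` sphere -> Q !=set0 ->
  (forall q, Q q -> regular_at q T) ->
  splitting_generator kappa \1_(has_cell (containing Q)) T =
  - fine (kappa (separating Q)) * \1_(has_cell (containing Q)) T.
Proof.
move=> fQ Q1 Q0 reg; have [q0 Qq0] := Q0.
have fT := finite_tessellation T.
rewrite /splitting_generator.
have [TQ|TQ] := pselect (has_cell (containing Q) T); last first.
  rewrite (indic_notin _ TQ) mulr0 (fsbig_finite _ _ fT) big_seq big1//= => c.
  rewrite in_fset_set// inE => Tc.
  rewrite (eq_Rintegral _ (g := cst 0)) ?/Rintegral ?integral0// => S /[!inE] cS.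
  by rewrite subr0 indic_notin// => /(has_cell_oslash_sub Tc cS).
rewrite (indic_in _ TQ) mulr1.
have [c0 [Tc0 Qc0]] := TQ.
(* Splitting a cell other than c0 leaves c0 in place, so only the summand of c0 survives. *)
rewrite (fsbigD1 c0)//= (fsbig_finite _ _ _)/=; last exact: finite_setD.
rewrite big_seq big1 ?addr0 => [|c]; last first.
  rewrite in_fset_set ?inE; last exact: finite_setD.
  move=> -[Tc cc0].
  rewrite (eq_Rintegral _ (g := cst 0)) ?/Rintegral ?integral0// => S /[!inE] cS.
  rewrite indic_in ?subrr//.
  by apply: (has_cell_oslash_other Tc cS Tc0) => // /esym.
have mSep : measurable (separating Q) by exact: measurable_separating.
have sepE : separating Q `<=` hits c0.
  move=> S; apply: separating_hits => // q Qq.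
  by apply: (regular_at_sinterior (T := T)); [exact: Q1|exact: reg| |exact: Qc0].
rewrite (eq_Rintegral _ (g := fun S => - \1_(separating Q) S)) => [|S /[!inE] cS];
  last first.
  have := has_cell_oslash Q1 Q0 reg Tc0 Qc0 cS.
  move=> H; have [sep|nsep] := pselect (separating Q S).
    by rewrite (indic_in _ sep) indic_notin ?sub0r//; move/H; apply.
  by rewrite (indic_notin _ nsep) indic_in ?subrr ?oppr0//; exact/H.
rewrite RintegralN; congr (- _); rewrite Rintegral_mkcond.
rewrite (_ : _ \_ _ = (\1_(separating Q) : _ -> R)); last first.
  apply/funext => S; rewrite patchE; case: ifPn => // /negP nS.
  by rewrite indic_notin// => /sepE/mem_set.
by rewrite /Rintegral integral_indic// setIT.
Qed.

End splitting_generator_values.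

(** * One-dimensional laws of the splitting process *)

Section splitting_law.
Context {R : realType} {d : nat}.
Local Notation V := 'rV[R]_d.+1.
Local Notation tessellation := (tessellation R d).
Variable kappa : probability (hypersphere R d) R.
Hypotheses (d0 : (0 < d)%N) (kreg : regular kappa).
Variable p : R -> R.-pker tessellation ~> tessellation.
Hypotheses (pT : transition_semigroup p)
  (pA : semigroup_generator p (splitting_generator kappa)).

Let p0 : forall T (B : set tessellation), measurable B -> p 0 T B = \d_T B.
Proof. by case: pT. Qed.

Let pD : forall (s t : R) T (B : set tessellation), 0 <= s -> 0 <= t -> measurable B ->
  p (s + t) T B = (\int[p s T]_T' p t T' B)%E.
Proof. by case: pT. Qed.

Let growth := generator_growth p0 pD pA measurable_ncells measurable_tessellation1
  (splitting_generator_singleton kappa) (splitting_generator_trunc kappa).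

Let p_indic t T (E : set tessellation) : measurable E ->
  \int[p t T]_T' \1_E T' = fine (p t T E).
Proof. by move=> mE; rewrite /Rintegral integral_indic// setIT. Qed.

Let p_fin t T (E : set tessellation) : measurable E -> p t T E \is a fin_num.
Proof. by apply: unit_mass_fin_num; exact: prob_kernel. Qed.

Lemma regular_at_tess0 q : sphere q -> regular_at q (tess0 R d).
Proof.
move=> q1; apply/regular_atP; exists (whole_sphere R d); split=> //.
Qed.

(** The growth estimate with rate 0, started at the value 0 of the indicator at the trivial
    tessellation. *)
Lemma transition_irregular t q : 0 <= t -> sphere q ->
  p t (tess0 R d) (~` regular_at q) = 0%E.
Proof.
move=> t0 q1; have mE := measurableC (measurable_regular_at q1).
have := @growth \1_(~` regular_at q) 1 0 (tess0 R d) _ (@indic_le1 _ _ _) _ t t0.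
rewrite p_indic// mul0r expR0 mul1r indic_notin; last first.
  by move=> /(_ (regular_at_tess0 q1)).
move=> H; apply/eqP; rewrite eq_le measure_ge0 andbT -[leLHS]fineK ?p_fin//.
rewrite lee_fin; apply: H.
  by apply: (@measurable_indic _ _ _ setT).
move=> s s0; apply: aeW => T; rewrite mul0r.
exact: splitting_generator_irregular.
Qed.

Lemma transition_has_cell t (Q : set V) : 0 <= t -> finite_set Q -> Q `<=` sphere ->
  Q !=set0 -> p t (tess0 R d) (has_cell (containing Q)) =
  (expR (- (t * fine (kappa (separating Q)))))%:E.
Proof.
move=> t0 fQ Q1 Q0.
have mE : measurable (has_cell (containing Q)).
  by apply: measurable_has_cell; exact: measurable_containing.
have mI : measurable_fun setT (\1_(has_cell (containing Q)) : tessellation -> R).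
  exact: measurable_indic.
have T0Q : has_cell (containing Q) (tess0 R d) by exists (whole_sphere R d).
pose k := - fine (kappa (separating Q)).
have AE s : 0 <= s -> {ae p s (tess0 R d), forall T,
    splitting_generator kappa \1_(has_cell (containing Q)) T =
    k * \1_(has_cell (containing Q)) T}.
  move=> s0; have : {ae p s (tess0 R d), forall T, forall q, Q q -> regular_at q T}.
    apply: ae_finite_forall => // q /Q1 q1; exists (~` regular_at q); split=> //.
      by apply: measurableC; exact: measurable_regular_at.
    exact: transition_irregular.
  apply: filterS => T; exact: splitting_generator_has_cell.
have up : fine (p t (tess0 R d) (has_cell (containing Q))) <= expR (k * t).
  rewrite -p_indic// -[leRHS]mulr1.
  have -> : 1 = \1_(has_cell (containing Q)) (tess0 R d) :> R by rewrite indic_in.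
  apply: (@growth _ 1) => // [T|s s0]; first exact: indic_le1.
  by apply: filterS (AE s s0) => T ->.
(* The same growth estimate, for the negative of the indicator. *)
have lo : expR (k * t) <= fine (p t (tess0 R d) (has_cell (containing Q))).
  rewrite -p_indic// -[leLHS]mulr1 -lerN2 -RintegralN -mulrN.
  have -> : 1 = \1_(has_cell (containing Q)) (tess0 R d) :> R by rewrite indic_in.
  apply: (@growth (fun T => - \1_(has_cell (containing Q)) T) 1) => //.
  - exact: measurable_funN.
  - by move=> T; rewrite normrN; exact: indic_le1.
  - move=> s s0; apply: filterS (AE s s0) => T E.
    by rewrite splitting_generatorN E mulrN.
rewrite -[LHS]fineK ?p_fin//; congr (_%:E); apply/eqP; rewrite eq_le.
by rewrite -mulrN mulrC up lo.
Qed.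

End splitting_law.
(** * The Poisson great hypersphere tessellation *)

Section components.
Context {R : realType} {d : nat}.
Local Notation V := 'rV[R]_d.+1.
Local Notation hypersphere := (hypersphere R d).
Local Notation tessellation := (tessellation R d).
Implicit Types (u v x y z q : V) (S : hypersphere) (H : set hypersphere) (Q : set V).

Lemma dot_continuous u : continuous (dot u).
Proof.
move=> x; apply/(@cvgrPdist_lt _ _ _ (nbhs x) (nbhs_filter x)) => e e0;
  apply/nbhs_edistP.
have u1 : 0 < enorm u + 1 by rewrite ltr_wpDl// enorm_ge0.
exists (e / (enorm u + 1)); first by rewrite divr_gt0.
move=> y; rewrite ltr_pdivlMr// => xy /=; apply: le_lt_trans (dot_edist _ _ _) _.
apply: le_lt_trans xy; rewrite mulrC ler_wpM2l ?edist_ge0// lerDl//.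
Qed.

Lemma enorm_continuous : continuous (@enorm R d).
Proof.
move=> x; apply/(@cvgrPdist_lt _ _ _ (nbhs x) (nbhs_filter x)) => e e0;
  apply/nbhs_edistP; exists e => // y xy /=.
apply: le_lt_trans xy; rewrite ler_norml; apply/andP; split.
  have := enormD (y - x) x; rewrite subrK -edistE edistC; lra.
by have := enormD (x - y) y; rewrite subrK -edistE; lra.
Qed.

Lemma normalize_continuous v : v != 0 -> {for v, continuous (@normalize R d)}.
Proof.
move=> v0.
have c1 : (enorm w)^-1 @[w --> v] --> (enorm v)^-1.
  apply: (@cvgV _ _ (nbhs v) (nbhs_filter v) enorm (enorm v)).
    by rewrite gt_eqF// enorm_gt0.
  exact: enorm_continuous.
by apply: (cvgZ c1); exact: cvg_id.
Qed.

Definition complement H : set V := sphere `\` \bigcup_(S in H) sval S.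

Lemma complementP H x : complement H x <->
  sphere x /\ forall S, H S -> dot (unit_normal S) x != 0.
Proof.
split=> -[x1 Hx]; split=> //.
  by move=> S HS; apply/eqP => ux; apply: Hx; exists S => //; rewrite unit_normalE.
by move=> [S HS]; rewrite unit_normalE => -[_ ux]; have := Hx S HS; rewrite ux eqxx.
Qed.

Definition same_side H x y := forall S, H S -> 0 < height_product x y S.

(** The image of the component under [dot (unit_normal S)] is an interval that omits 0. *)
Lemma component_same_side H x y : connected_component (complement H) x y ->
  same_side H x y.
Proof.
move=> xy S HS; set C := connected_component (complement H) x in xy.
have Cx : C x.
  have [//|/connected_component_out E] := pselect (complement H x).
    exact: connected_component_refl.
  by move: xy; rewrite /C E.
have HC z : C z -> dot (unit_normal S) z != 0.
  by move=> /connected_component_sub/complementP[_]; apply.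
have : is_interval (dot (unit_normal S) @` C).
  apply/connected_intervalP/connected_continuous_connected.
    exact: component_connected.
  by apply: continuous_subspaceT; exact: dot_continuous.
move=> I; rewrite /height_product ltNge; apply/negP => le0.
have [x0 y0] := (HC _ Cx, HC _ xy).
have I0 z w : C z -> C w -> dot (unit_normal S) z <= 0 ->
  0 <= dot (unit_normal S) w -> False.
  move=> Cz Cw z0 w0;
    have [] := I (dot (unit_normal S) z) (dot (unit_normal S) w) _ _ 0.
  - by exists z.
  - by exists w.
  - by rewrite z0.
  - by move=> v Cv v0; have := HC v Cv; rewrite v0 eqxx.
have [ux|ux] := leP (dot (unit_normal S) x) 0.
  apply: (I0 x y) => //; rewrite leNgt; apply/negP => uy; move: le0.
  by rewrite nmulr_lle0// leNgt lt_neqAle x0 ux.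
apply: (I0 y x) => //; last exact: ltW.
by move: le0; rewrite pmulr_rle0.
Qed.

(** The segment from x to y, projected to the sphere, is a connected set avoiding H. Antipodal
    points are excluded because their segment passes through 0. *)
Lemma segment_component H x y : complement H x -> complement H y -> same_side H x y ->
  y != - x -> connected_component (complement H) x y.
Proof.
move=> /complementP[x1 Hx] /complementP[y1 Hy] xy yNx.
pose g (s : R) : V := (1 - s) *: x + s *: y.
have g0 s : `[0, 1]%classic s -> g s != 0.
  rewrite /= in_itv /= => /andP[s0 s1]; apply: contraNneq yNx => /eqP.
  rewrite /g addr_eq0 -scalerN => /eqP E.
  have := congr1 enorm E; rewrite !enormZ enormN !sphere_enorm// !mulr1.
  rewrite !ger0_norm ?subr_ge0// => E1.
  have s2 : s = 1 / 2 by lra.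
  have h0 : (1 / 2 : R) != 0 by rewrite div1r invr_eq0 pnatr_eq0.
  by move: E; rewrite E1 s2 => /(scalerI h0) ->; rewrite opprK.
have gn s : `[0, 1]%classic s -> complement H (normalize (g s)).
  move=> s01; apply/complementP; split; first exact/normalize_sphere/g0.
  move=> S HS; suff : dot (unit_normal S) (g s) != 0.
    move=> ug; rewrite dotZr mulf_neq0// invr_eq0 -/(enorm _) gt_eqF//.
    by rewrite enorm_gt0 g0.
  move: s01; rewrite /= in_itv /= => /andP[s0 s1].
  apply: contraTneq (xy S HS) => E; rewrite /height_product -leNgt.
  move: E; rewrite /g dotDr !dotZr => E.
  have [s0'|s0'] := eqVneq s 0.
    by move: E (Hx S HS); rewrite s0' subr0 mul1r mul0r addr0 => ->; rewrite eqxx.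
  have -> : dot (unit_normal S) y = - ((1 - s) / s * dot (unit_normal S) x).
    apply: (mulfI s0'); set ux := dot _ x in E *; set uy := dot _ y in E *.
    have -> : s * - ((1 - s) / s * ux) = - ((1 - s) * ux) by field.
    lra.
  by rewrite mulrN oppr_le0 mulrCA mulr_ge0 ?divr_ge0 ?subr_ge0// -expr2 sqr_ge0.
have norm1 z : sphere z -> normalize z = z.
  by move=> z1; rewrite /normalize -/(enorm z) sphere_enorm// invr1 scale1r.
have cI : connected ((@normalize R d \o g) @` `[0, 1]%classic).
  apply: connected_continuous_connected; first exact: segment_connected.
  apply: continuous_in_subspaceT => s; rewrite inE => s01.
  apply: continuous_comp; last exact/normalize_continuous/g0.
  rewrite /g; apply: cvgD; apply: cvgZr_tmp; last exact: cvg_id.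
  by apply: cvgB; [exact: cvg_cst|exact: cvg_id].
apply: (connected_component_max _ _ cI).
- exists 0; first by rewrite /= in_itv /= lexx ler01.
  by rewrite /g /= subr0 scale1r scale0r addr0 norm1.
- by move=> _ [s s01 <-]; exact: gn.
- exists 1; first by rewrite /= in_itv /= lexx ler01.
  by rewrite /g /= subrr scale1r scale0r add0r norm1.
Qed.

Hypothesis d0 : (0 < d)%N.

Lemma same_side_component H x y : complement H x -> complement H y -> same_side H x y ->
  connected_component (complement H) x y.
Proof.
(* Antipodal points are on the same side of every member of H only if H is empty; a detour through a
   point orthogonal to x then connects them. *)
move=> Hx Hy xy; have [yx|yx] := eqVneq y (- x); last exact: segment_component.
have H0 S : ~ H S.
  move=> HS; have := xy S HS; rewrite yx /height_product dotNr mulrN oppr_gt0.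
  by rewrite -expr2 ltNge sqr_ge0.
have [x1 _] := Hx; have [z z1 xz] := exists_orthogonal x d0.
have zx : z != - x.
  by apply: contra_eq_neq xz => ->; rewrite dotNr x1 oppr_eq0 oner_eq0.
have zx' : - x != - z.
  by rewrite eqr_opp; apply: contra_eq_neq xz => <-; rewrite x1 oner_eq0.
have Hz : complement H z by split=> // -[S /H0].
apply: (@connected_component_trans _ _ z).
  by apply: segment_component => // S /H0.
by apply: segment_component => //; rewrite ?yx// => S /H0.
Qed.

Lemma closure_component_side H x z S : complement H x -> H S ->
  closure (connected_component (complement H) x) z -> 0 <= height_product x z S.
Proof.
move=> Hx HS clz; rewrite leNgt; apply/negP => xz.
have [] := clz [set y | height_product x y S < 0].
  have : height_product x y S @[y --> z] --> height_product x z S.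
    apply: (@cvgM _ _ (nbhs z) (nbhs_filter z)); first exact: cvg_cst.
    exact: dot_continuous.
  by move=> /(@cvgr_lt _ _ (nbhs z) (nbhs_filter z)); exact.
by move=> y [/component_same_side/(_ S HS) + /=]; lra.
Qed.

Section cells.
Variables (H : set hypersphere) (T : tessellation).
Hypothesis TH : [set sval c | c in sval T] = hypersphere_cells H.

Let cell_of x : complement H x ->
  exists2 c, sval T c & sval c = closure (connected_component (complement H) x).
Proof.
move=> Hx; have : hypersphere_cells H (closure (connected_component (complement H) x)).
  by exists x.
by rewrite -TH => -[c Tc cE]; exists c.
Qed.

Let of_cell c : sval T c -> exists2 x, complement H x &
  sval c = closure (connected_component (complement H) x).
Proof.
move=> Tc; have : hypersphere_cells H (sval c) by rewrite -TH; exists c.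
by move=> [x Hx <-]; exists x.
Qed.

(** If q lies in the closure of the component of x, then q is weakly, hence strictly, on the side of
    x for each hypersphere, so q is in that very component. *)
Lemma regular_at_cells q : complement H q -> regular_at q T.
Proof.
move=> Hq; apply/regular_atP; have [c0 Tc0 c0E] := cell_of Hq.
exists c0; split=> //.
  by rewrite c0E; apply: subset_closure; exact: connected_component_refl.
move=> c Tc cq; have [x Hx cE] := of_cell Tc.
apply: polytope_inj; rewrite cE c0E; congr closure.
apply: same_connected_component; apply: same_side_component => // S HS.
rewrite lt_neqAle eq_sym; move: cq; rewrite cE => /(closure_component_side Hx HS) ->.
have /complementP[_ /(_ S HS) x0] := Hx; have /complementP[_ /(_ S HS) q0] := Hq.
by rewrite mulf_neq0.
Qed.

Lemma has_cell_cells Q : Q !=set0 -> Q `<=` complement H ->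
  has_cell (containing Q) T <-> H `&` separating Q = set0.
Proof.
move=> [q Qq] QH; split=> [[c [Tc Qc]]|HQ].
  rewrite -subset0 => S [HS [x [y [Qx Qy]]]].
  have [z Hz cE] := of_cell Tc.
  have := Qc _ Qx; rewrite cE => /(closure_component_side Hz HS).
  have := Qc _ Qy; rewrite cE => /(closure_component_side Hz HS).
  rewrite /height_product => zy zx xy.
  have /complementP[_ /(_ S HS) z0] := Hz.
  have {}z0 : 0 < dot (unit_normal S) z ^+ 2 by rewrite lt_neqAle eq_sym sqrf_eq0 z0 sqr_ge0.
  have := mulr_ge0 zx zy; rewrite mulrACA -expr2 pmulr_rge0// leNgt.
  by rewrite xy.
have [c Tc cE] := cell_of (QH _ Qq); exists c; split=> // y Qy.
rewrite cE; apply: subset_closure; apply: same_side_component; [exact: QH|exact: QH|].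
move=> S HS; rewrite lt_neqAle eq_sym.
have /complementP[_ /(_ S HS) y0] := QH _ Qy;
  have /complementP[_ /(_ S HS) q0] := QH _ Qq.
rewrite mulf_neq0//= leNgt; apply/negP => qy.
by have : (H `&` separating Q) S; [split=> //; exists q, y|rewrite HQ].
Qed.

End cells.
End components.

(** * Void probabilities of the Poisson process *)

Section poisson_law.
Context {R : realType} {d : nat}.
Local Notation V := 'rV[R]_d.+1.
Local Notation tessellation := (tessellation R d).
Context {dO : measure_display} {Omega : measurableType dO}.
Variables (P : probability Omega R) (kappa : probability (hypersphere R d) R) (t : R).
Variable X : Omega -> tessellation.
Hypotheses (d0 : (0 < d)%N) (kreg : regular kappa).
Hypothesis HX : poisson_tessellation P kappa t X.

Lemma poisson_avoids (eta : Omega -> set (hypersphere R d)) q :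
  poisson_process P (fun B => t%:E * kappa B)%E eta -> sphere q ->
  {ae P, forall w S, eta w S -> ~ sval S q}.
Proof.
move=> [mN PN _] q1; have mB := measurable_through d0 q1.
set B := [set S : hypersphere R d | sval S q] in mB.
have mN0 := mN B 0%N mB.
have P1 : P [set w | eta w `&` B #= `I_0] = 1%E.
  by rewrite PN// kreg// mule0 expr0 fact0 divr1 oppr0 expR0 mulr1.
exists (~` [set w | eta w `&` B #= `I_0]); split.
- exact: measurableC.
- by rewrite probability_setC// P1 subee.
- move=> w; apply: contra_not => /=; rewrite II0 card_eq0 => /eqP E S eS Sq.
  by have : (eta w `&` B) S; [|rewrite E].
Qed.

Lemma poisson_regular_at q : sphere q -> {ae P, forall w, regular_at q (X w)}.
Proof.
move=> q1; have [mX [eta Peta cells]] := HX.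
apply: filterS2 cells (poisson_avoids Peta q1) => w XE avoid.
apply: (regular_at_cells d0 XE); split=> // -[S eS Sq]; exact: avoid eS Sq.
Qed.

Lemma poisson_has_cell (Q : set V) : finite_set Q -> Q `<=` sphere -> Q !=set0 ->
  P (X @^-1` has_cell (containing Q)) =
  (expR (- (t * fine (kappa (separating Q)))))%:E.
Proof.
move=> fQ Q1 Q0; have [mX [eta Peta cells]] := HX.
have mS : measurable (separating Q) by exact: measurable_separating.
have [mN PN _] := Peta.
have kfin : kappa (separating Q) = (fine (kappa (separating Q)))%:E.
  by rewrite fineK// fin_num_measure.
(* The two events agree only almost surely, so they are compared through the integrals of their
   indicators. *)
transitivity (P [set w | eta w `&` separating Q #= `I_0]).
  have mE : measurable (X @^-1` has_cell (containing Q)).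
    rewrite -[X in measurable X]setTI; apply: mX => //.
    by apply: measurable_has_cell; exact: measurable_containing.
  have mN0 := mN _ 0%N mS.
  have av : {ae P, forall w, forall q, Q q -> forall S, eta w S -> ~ sval S q}.
    by apply: ae_finite_forall => // q /Q1; exact: poisson_avoids.
  have Pi E : measurable E -> P E = (\int[P]_w (\1_E w)%:E)%E.
    by move=> mE'; rewrite integral_indic// setIT.
  rewrite (Pi _ mE) (Pi _ mN0).
  apply: ae_eq_integral => //; first exact/measurable_EFinP.
    exact/measurable_EFinP.
  apply: filterS2 cells av => w XE avoid _; congr (_%:E).
  have QU : Q `<=` complement (eta w).
    by move=> q Qq; split; [exact: Q1|move=> [S eS Sq]; exact: (avoid q Qq S eS Sq)].
  have := has_cell_cells d0 XE Q0 QU => -[H1 H2].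
  have [h|h] := pselect (has_cell (containing Q) (X w)).
    by rewrite !indic_in//= II0 card_eq0 H1.
  by rewrite !indic_notin//= II0 card_eq0 => /eqP/H2.
rewrite PN// expr0 fact0 divr1 mul1r; congr (expR (- _))%:E.
by rewrite kfin.
Qed.

End poisson_law.
(** * Cell intensity measures *)

Section cell_measure.
Context {R : realType} {d : nat}.
Local Notation V := 'rV[R]_d.+1.
Local Notation polytope := (polytope R d).
Local Notation tessellation := (tessellation R d).
Implicit Types (T : tessellation) (B : set polytope) (Q : set V).

Definition cell_count T B : \bar R := (\sum_(c \in sval T) (\d_c B : \bar R))%E.

Lemma cell_countE T B : cell_count T B =
  (\sum_(c <- fset_set (sval T)) (\d_c B : \bar R))%E.
Proof. by rewrite /cell_count (fsbig_finite _ _ (finite_tessellation T)). Qed.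

Lemma cell_count_ge0 T B : (0 <= cell_count T B)%E.
Proof. by rewrite cell_countE; apply: sume_ge0. Qed.

Lemma cell_count_card T B n : sval T `&` B #= `I_n -> cell_count T B = n%:R%:E.
Proof.
move=> TBn; rewrite /cell_count.
transitivity (\sum_(c \in sval T `&` B) (1%:E : \bar R))%E.
  by rewrite fsbig_mkcondr; apply: eq_fsbigr => c _; rewrite diracE; case: (c \in B).
rewrite fsbig_finite/=; last exact/finite_setIl/finite_tessellation.
by rewrite -(card_fset_set TBn) sumEFin big_tnth sumr_const card_ord.
Qed.

Lemma measurable_cell_count B : measurable B -> measurable_fun setT (cell_count ^~ B).
Proof.
move=> mB _ Y mY; rewrite setTI.
have -> : cell_count ^~ B @^-1` Y =
    \bigcup_(n in [set n | Y n%:R%:E]) [set T : tessellation | sval T `&` B #= `I_n].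
  apply/seteqP; split=> T /=; last by move=> [n /= Yn] /cell_count_card ->.
  have /finite_setP[n Tn] : finite_set (sval T `&` B).
    exact/finite_setIl/finite_tessellation.
  by rewrite (cell_count_card Tn) => Yn; exists n.
by apply: bigcup_measurable => n _; exact: measurable_card_cells.
Qed.

Lemma cell_count_sigma_additive T (F : (set polytope)^nat) :
  (forall i, measurable (F i)) -> trivIset setT F ->
  cell_count T (\bigcup_n F n) = (\sum_(0 <= i <oo) cell_count T (F i))%E.
Proof.
move=> mF tF; rewrite cell_countE.
transitivity (\sum_(c <- fset_set (sval T)) \sum_(0 <= i <oo) (\d_c (F i) : \bar R))%E.
  apply: eq_bigr => c _; rewrite measure_semi_bigcup//.
  exact: bigcupT_measurable.
rewrite -nneseries_sum//; apply: eq_eseriesr => i _.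
by rewrite cell_countE.
Qed.

Section measure.
Context {dO : measure_display} {Omega : measurableType dO}.
Variables (P : probability Omega R) (X : Omega -> tessellation).
Hypothesis mX : measurable_fun setT X.

Let mcount B : measurable B -> measurable_fun setT (fun w => cell_count (X w) B).
Proof.
by move=> mB; exact: measurableT_comp (measurable_cell_count mB) mX.
Qed.

(** The measurability proof is an argument so that the measure structure declared below can be
    attached to [cell_measure mX]. *)
Definition cell_measure of measurable_fun setT X : set polytope -> \bar R :=
  cell_intensity P X.

Let cell_measure0 : cell_measure mX set0 = 0%E.
Proof.
rewrite /cell_measure /cell_intensity integral0_eq// => w _.
by rewrite fsbig1// => c _; rewrite measure0.
Qed.

Let cell_measure_ge0 B : (0 <= cell_measure mX B)%E.
Proof. by apply: integral_ge0 => w _; exact: cell_count_ge0. Qed.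

Let cell_measure_additive : semi_sigma_additive (cell_measure mX).
Proof.
move=> F mF tF mUF; rewrite [X in _ --> X](_ : _ =
  (\int[P]_w \sum_(0 <= n <oo) cell_count (X w) (F n))%E); last first.
  by apply: eq_integral => w _; exact: cell_count_sigma_additive.
apply/cvg_closeP; split.
  by apply: is_cvg_nneseries => n _ _; exact: cell_measure_ge0.
rewrite closeE// integral_nneseries// => [n|n w _]; first exact: mcount.
exact: cell_count_ge0.
Qed.

HB.instance Definition _ := isMeasure.Build _ _ _ (cell_measure mX)
  cell_measure0 cell_measure_ge0 cell_measure_additive.

Lemma eq_cell_intensity_full B B' : (forall c, full c -> (B c <-> B' c)) ->
  cell_intensity P X B = cell_intensity P X B'.
Proof.
move=> BB'; apply: eq_integral => w _; apply: eq_fsbigr => c; rewrite inE => Xc.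
rewrite !diracE; congr (nat_of_bool _)%:R%:E; apply/idP/idP;
  by rewrite !inE => /BB'; apply; exact: tessellation_full Xc.
Qed.

Lemma cell_intensity_containing Q : finite_set Q -> Q `<=` sphere -> Q !=set0 ->
  (forall q, sphere q -> {ae P, forall w, regular_at q (X w)}) ->
  cell_intensity P X (containing Q) = P (X @^-1` has_cell (containing Q)).
Proof.
move=> fQ Q1 [q Qq] reg.
have mQ := measurable_containing fQ Q1.
have mE : measurable (X @^-1` has_cell (containing Q)).
  by rewrite -[X in measurable X]setTI; apply: mX => //; exact: measurable_has_cell.
have -> : P (X @^-1` has_cell (containing Q)) =
    (\int[P]_w (\1_(X @^-1` has_cell (containing Q)) w)%:E)%E.
  by rewrite integral_indic// setIT.
apply: ae_eq_integral => //; first exact: mcount.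
  exact/measurable_EFinP.
apply: filterS (reg q (Q1 q Qq)) => w /regular_atP[c0 [Xc0 c0q uniq]] _.
rewrite -/(cell_count (X w) (containing Q)).
have [[c [Xc Qc]]|h] := pselect (has_cell (containing Q) (X w)).
  rewrite indic_in; last by exists c.
  apply: (@cell_count_card _ _ 1%N).
  rewrite (_ : _ `&` _ = [set c]); first exact: card_set1.
  apply/seteqP; split=> c' /=; last by move=> ->.
  move=> [Xc' Qc']; rewrite (uniq c' Xc' (Qc' _ Qq)).
  by rewrite (uniq c Xc (Qc _ Qq)).
rewrite indic_notin//; apply: (@cell_count_card _ _ 0%N).
rewrite II0 card_eq0; apply/eqP; rewrite -subset0 => c [Xc Qc].
by apply: h; exists c.
Qed.

End measure.

(* The class G is a pi-system covering the space of polytopes once the set Z of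
   polytopes without grid points is added; Z carries no mass because cells are
   full-dimensional. *)
Lemma cell_intensity_uniq {dO1 dO2 : measure_display} {Omega1 : measurableType dO1}
    {Omega2 : measurableType dO2} (P1 : probability Omega1 R)
    (P2 : probability Omega2 R) (X1 : Omega1 -> tessellation)
    (X2 : Omega2 -> tessellation) (mX1 : measurable_fun setT X1)
    (mX2 : measurable_fun setT X2) :
  (forall Q, finite_set Q -> Q `<=` sphere -> Q !=set0 ->
    cell_intensity P1 X1 (containing Q) = cell_intensity P2 X2 (containing Q) /\
    (cell_intensity P1 X1 (containing Q) < +oo)%E) ->
  forall B, measurable B -> cell_intensity P1 X1 B = cell_intensity P2 X2 B.
Proof.
move=> H B mB.
have [B' mB' BB'] := borel_grid mB.
rewrite (eq_cell_intensity_full P1 X1 BB') (eq_cell_intensity_full P2 X2 BB').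
pose m1 : {measure set polytope -> \bar R} := cell_measure P1 mX1.
pose m2 : {measure set polytope -> \bar R} := cell_measure P2 mX2.
pose Z : set polytope := \bigcap_(q : @grid_index d) ~` containing [set grid q].
have mq q : measurable (containing [set (grid q : V)]).
  by apply: measurable_containing1; exact: grid_sphere.
have mZ : measurable Z.
  rewrite -[Z]setCK; apply: measurableC; rewrite /Z setC_bigcap.
  by apply: bigcup_countType_measurable => q _; rewrite setCK.
have Zfull c : full c -> (Z c <-> set0 c).
  move=> fc; split=> // Zc; have [x cx] := polytope_nonempty c.
  have [q /sinterior_sub cq _] := full_grid_dense fc cx ltr01.
  by apply: (Zc q I) => _ ->.
(* F is nonempty, because the empty F gives the set of all polytopes, whose mass is not controlled
   by H. *)
pose G : set (set polytope) := [set E | E = Z \/ E = set0 \/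
  exists F : seq (@grid_index d), F != [::] /\ E =
    containing [set grid q | q in [set` F]]].
have finF (F : seq (@grid_index d)) : finite_set [set (grid q : V) | q in [set` F]].
  by apply: finite_image; exact: finite_seq.
have subF (F : seq (@grid_index d)) : [set (grid q : V) | q in [set` F]] `<=` sphere.
  by move=> _ [q _ <-]; exact: grid_sphere.
have GZ : m1 Z = 0%E /\ m2 Z = 0%E.
  split; [rewrite -(measure0 m1)|rewrite -(measure0 m2)];
    exact: (eq_cell_intensity_full _ _ Zfull).
(* The countable cover by sets of finite mass that the uniqueness theorem requires: Z at index 0,
   then the events of the grid points, with Z again for codes of no grid point. *)
pose g k : set polytope := if k is k'.+1 then
    (if unpickle k' is Some q then containing [set grid (q : @grid_index d)] else Z)
  else Z.
have Gq q : G (containing [set grid q]).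
  right; right; exists [:: q]; split=> //; congr containing.
  apply/seteqP; split=> x /=; first by move=> ->; exists q => //=; rewrite inE.
  by move=> [q' /=]; rewrite inE => /eqP -> ->.
have Gm : G `<=` measurable.
  move=> _ [->//|[->//|[F [_ ->]]]].
  exact: measurable_containing.
have GGZ E : G E -> m1 E = m2 E /\ (m1 E < +oo)%E.
  move=> [->|[->|[F [F0 ->]]]].
  - by rewrite GZ.1 GZ.2 ltry.
  - by rewrite !measure0 ltry.
  - apply: H => //; case: F F0 => // q F _; exists (grid q), q => //=.
    by rewrite inE eqxx.
have sub : <<s grid_sets >> `<=` <<s G >>.
  apply: smallest_sub; first exact: smallest_sigma_algebra.
  move=> _ [[|q F] ->].
    have -> : containing [set grid q | q in [set` [::]]] = setT :> set polytope.
      by apply/seteqP; split=> // c _ x [].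
    exact: (@measurableT _ (g_sigma_algebraType G)).
  by apply: sub_sigma_algebra; right; right; exists (q :: F).
apply: (@g_sigma_algebra_measure_unique _ _ _ G Gm g _ _ m1 m2).
- case=> [|k /=]; first by left.
  by case: unpickle => [q|]; [exact: Gq|left].
- rewrite -subTset => c _; have [Zc|] := pselect (Z c); first by exists 0%N.
  move=> /existsNP[q /not_implyP[_ /contrapT qc]].
  by exists (pickle q).+1 => //=; rewrite pickleK.
- move=> A C [->|[->|[F [F0 ->]]]] [->|[->|[F' [F'0 ->]]]].
  - by rewrite setIid; left.
  - by rewrite setI0; right; left.
  - right; left; rewrite -subset0 => c [Zc Fc]; case: F' F'0 Fc => // q F' _ Fc.
    apply: (Zc q I) => _ ->; apply: Fc; exists q => //=; by rewrite inE eqxx.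
  - by rewrite set0I; right; left.
  - by rewrite set0I; right; left.
  - by rewrite set0I; right; left.
  - right; left; rewrite -subset0 => c [Fc Zc]; case: F F0 Fc => // q F _ Fc.
    apply: (Zc q I) => _ ->; apply: Fc; exists q => //=; by rewrite inE eqxx.
  - by rewrite setI0; right; left.
  - right; right; exists (F ++ F'); split; first by case: F F0.
    apply/seteqP; split=> c /=.
      move=> [Fc F'c] _ [q /= + <-]; rewrite mem_cat => /orP[qF|qF'].
        by apply: Fc; exists q.
      by apply: F'c; exists q.
    move=> FF'c; split=> _ [q /= qF <-]; apply: FF'c; exists q => //=;
      by rewrite mem_cat qF ?orbT.
- by move=> E /GGZ[].
- move=> k; suff : G (g k) by move=> /GGZ[].
  case: k => [|k /=]; first by left.
  by case: unpickle => [q|]; [exact: Gq|left].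
- exact: sub mB'.
Qed.

End cell_measure.

(** * From the transition semigroup to the law at time t *)

Section splitting_intensity.
Context {R : realType} {d : nat}.
Local Notation tessellation := (tessellation R d).
Context {dO : measure_display} {Omega : measurableType dO}.
Variables (P : probability Omega R) (Y : R -> Omega -> tessellation).

(** The Markov property at time 0 with the sure event as past. *)
Lemma markov_law (p : R -> R.-pker tessellation ~> tessellation) (t : R)
    (E : set tessellation) :
  markov_with P Y p -> measurable_fun setT (Y 0) ->
  {ae P, forall w, Y 0 w = tess0 R d} -> 0 <= t -> measurable E ->
  P (Y t @^-1` E) = p t (tess0 R d) E.
Proof.
move=> mk mY0 Y0 t0 mE.
have pT : past Y 0 setT.
  exact: (@measurableT _ (g_sigma_algebraType _)).
have := mk 0 t setT E (lexx 0) t0 pT mE; rewrite setTI add0r => ->.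
have mpE : measurable_fun setT (fun w => p t (Y 0 w) E).
  exact: measurableT_comp (measurable_kernel (p t) E mE) mY0.
rewrite (ae_eq_integral (cst (p t (tess0 R d) E)))//.
  rewrite integral_cst// [X in (_ * X)%E](_ : _ = 1%E) ?mule1//.
  exact: probability_setT.
by apply: filterS Y0 => w -> _.
Qed.

End splitting_intensity.

Theorem theorem7p4 (R : realType) (d : nat) (hd : (2 <= d)%N)
    (kappa : probability (hypersphere R d) R) (hkappa : regular kappa)
    (dO : measure_display) (Omega : measurableType dO)
    (P : probability Omega R) (Y : R -> Omega -> tessellation R d)
    (hY : splitting_process P Y kappa)
    (t : R) (ht : 0 <= t)
    (dO' : measure_display) (Omega' : measurableType dO')
    (P' : probability Omega' R) (Ybar : Omega' -> tessellation R d)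
    (hYbar : poisson_tessellation P' kappa t Ybar)
    (B : set (polytope R d)) (hB : measurable B) :
  cell_intensity P (Y t) B = cell_intensity P' Ybar B.
Proof.
have d0 : (0 < d)%N by exact: ltnW.
have [mY _ Y0 [p [pT pA mk]]] := hY.
have mYt := mY t ht.
have mYbar : measurable_fun setT Ybar by case: hYbar.
have law E : measurable E -> P (Y t @^-1` E) = p t (tess0 R d) E.
  exact: (markov_law mk (mY 0 (lexx 0)) Y0 ht).
have regY q : sphere q -> {ae P, forall w, regular_at q (Y t w)}.
  move=> q1; have mq := measurable_regular_at q1.
  exists (Y t @^-1` (~` regular_at q)); split=> //.
    by rewrite -[X in measurable X]setTI; apply: mYt => //; exact: measurableC.
  by rewrite law; [exact: (transition_irregular d0 hkappa pT pA)|exact: measurableC].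
apply: cell_intensity_uniq => // Q fQ Q1 Q0.
rewrite (cell_intensity_containing mYt fQ Q1 Q0 regY).
rewrite (cell_intensity_containing mYbar fQ Q1 Q0); last first.
  by move=> q; exact: (poisson_regular_at d0 hkappa hYbar).
rewrite (poisson_has_cell d0 hkappa hYbar fQ Q1 Q0).
rewrite law; last by apply: measurable_has_cell; exact: measurable_containing.
by rewrite (transition_has_cell d0 hkappa pT pA ht fQ Q1 Q0) ltry.
Qed.
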